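(* Let $\Sigma$ be the free semigroup (with identity) on a finite or countable non-empty set $W$, let $\mu$ be a generating probability measure on $\Sigma$, and let $(\partial\Sigma,\lambda)$ be the space of infinite words in the generators equipped with the hitting measure $\lambda$ of the random walk $(\Sigma,\mu)$. If either $\mu$ has finite entropy or $\mu$ has finite logarithmic moment, then $(\partial\Sigma,\lambda)$ is the Poisson boundary of the random walk $(\Sigma,\mu)$.
   Context: Free semigroup: $\Sigma$ is the set of finite words in the alphabet $W$ with concatenation; the empty word is the identity $e$; $|g|$ is the length of the word $g$. Generating: a probability measure $\mu$ on $\Sigma$ is generating if the semigroup with identity generated by its support is all of $\Sigma$. Random walk: for $g\in\Sigma$, $\mathbf{P}_g$ denotes the law, on the space $\Omega$ of sample paths $(x_n)_{n\ge 0}$ in $\Sigma$, of the process $x_0=g$, $x_n=g\,g_1\cdots g_n$, where $g_1,g_2,\dots$ are i.i.d. with law $\mu$. Put $\mathbf{P}=\mathbf{P}_e$. Infinite words and hitting measure: $\partial\Sigma=W^{\{1,2,\dots\}}$ with the product $\sigma$-algebra. A sequence of finite words $x_n$ converges to an infinite word $\boldsymbol{g}\in\partial\Sigma$ if every finite prefix of $\boldsymbol{g}$ is a prefix of $x_n$ for all sufficiently large $n$. $\mathbf{P}$-almost every sample path converges to a point of $\partial\Sigma$; the hitting measure $\lambda$ is the law of $\lim_n x_n$ under $\mathbf{P}$. Poisson boundary: fix a probability measure $m$ on $\Sigma$ with $m(g)>0$ for all $g$ and let $\mathbf{P}_m=\sum_g m(g)\mathbf{P}_g$. Two sample paths $(x_n),(y_n)$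 are equivalent if there are $i,j\ge 0$ with $x_{n+i}=y_{n+j}$ for all $n\ge0$. Let $\mathcal{A}$ be the $\sigma$-algebra (mod $0$ with respect to $\mathbf{P}_m$) of all measurable unions of equivalence classes. There are a (unique up to isomorphism) measurable space $\Gamma$ and a measurable map $\mathrm{bnd}:\Omega\to\Gamma$ such that $\mathcal{A}$ coincides mod $0$ with the $\sigma$-algebra of $\mathrm{bnd}$-preimages of measurable sets. The Poisson boundary is $(\Gamma,\nu)$ with $\nu=\mathrm{bnd}_\star\mathbf{P}$. The limit map $(x_n)\mapsto\lim_n x_n\in\partial\Sigma$ factors (mod $0$) through $\mathrm{bnd}$, giving a map $\Lambda:\Gamma\to\partial\Sigma$ with $\Lambda_\star\nu=\lambda$. Saying that $(\partial\Sigma,\lambda)$ is the Poisson boundary means that $\Lambda:(\Gamma,\nu)\to(\partial\Sigma,\lambda)$ is an isomorphism mod $0$; equivalently, every set in $\mathcal{A}$ coincides, up to a $\mathbf{P}$-null set, with the preimage under the limit map of a measurable subset of $\partial\Sigma$. Finite entropy: $-\sum_{g\in\Sigma}\mu(g)\log\mu(g)<\infty$, with $0\log 0=0$. Finite logarithmic moment: $\sum_{g\in\Sigma}\mu(g)\log|g|<\infty$, where the term $g=e$ is taken to be $0$. *)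

(* Defs.v *)
From HB Require Import structures.
From mathcomp Require Import all_boot all_order all_algebra.
From mathcomp Require Import finmap.
From mathcomp Require Import all_classical all_reals all_analysis.

Set Implicit Arguments.
Unset Strict Implicit.
Unset Printing Implicit Defensive.

Import Order.TTheory GRing.Theory Num.Theory.
Import numFieldNormedType.Exports.

Local Open Scope classical_set_scope.
Local Open Scope ring_scope.

(* Finite or countable non-empty sets. Non-emptiness is given by a
   distinguished point, as for every measurableType of the library. *)
#[short(type="pointedCountType")]
HB.structure Definition PointedCountable := {T of Pointed T & Countable T}.

(* The free semigroup with identity on W: finite words, with product ++ and
   identity [::], carrying the discrete sigma-algebra. *)
Definition word (W : Type) : Type := seq W.

HB.instance Definition _ (W : countType) := Countable.on (word W).
HB.instance Definition _ (W : countType) := isPointed.Build (word W) [::].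
HB.instance Definition _ (W : countType) :=
  @isMeasurable.Build default_measure_display (word W)
    discrete_measurable discrete_measurable0
    discrete_measurableC discrete_measurableU.

(* T^nat with the product of the discrete sigma-algebras on T; it is only used
   for countable T. *)
Definition coordinate_sets (T : Type) : set (set (nat -> T)) :=
  [set C | exists (n : nat) (B : set T), C = [set x | B (x n)]].

Definition sequence_space (T : pointedType) : Type :=
  g_sigma_algebraType (@coordinate_sets T).

HB.instance Definition _ (T : pointedType) :=
  Measurable.on (sequence_space T).

Definition path_space (W : pointedCountType) : Type :=
  sequence_space (word W).
HB.instance Definition _ (W : pointedCountType) :=
  Measurable.on (path_space W).

(* Letters of an infinite word are indexed from 0. *)
Definition infinite_words (W : pointedCountType) : Type := sequence_space W.
HB.instance Definition _ (W : pointedCountType) :=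
  Measurable.on (infinite_words W).

Section step_distribution.
Context {R : realType} {W : pointedCountType}.
Implicit Type mu : probability (word W) R.

(* [flatten s] is the product in the free semigroup of the words of s. *)
Definition generating mu : Prop :=
  forall g : word W, exists s : seq (word W),
    (forall h : word W, h \in s -> (0 < mu [set h])%E) /\ g = flatten s.

Definition finite_entropy mu : Prop :=
  (\esum_(g in [set: word W])
     (- (fine (mu [set g]) * ln (fine (mu [set g]))))%:E < +oo)%E.

(* The term of the empty word vanishes because [ln 0 = 0]. *)
Definition finite_log_moment mu : Prop :=
  (\esum_(g in [set: word W])
     (fine (mu [set g]) * ln (size g)%:R)%:E < +oo)%E.

End step_distribution.

Section random_walk.
Context {R : realType} {W : pointedCountType}.
Context {d : measure_display} {T : measurableType d} {Q : probability T R}.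
Implicit Types (mu m : probability (word W) R).
Implicit Type X : nat -> {RV Q >-> word W}.

Definition iid_with_law mu X : Prop :=
  (forall (i : nat) (A : set (word W)),
     measurable A -> distribution Q (X i) A = mu A) /\
  (forall (I : {fset nat}) (A : nat -> set (word W)),
     (forall i, measurable (A i)) ->
     Q (\bigcap_(i in [set` I]) (X i @^-1` A i)) =
       (\prod_(i <- I) Q (X i @^-1` A i))%E).

(* The increments g_1, g_2, ... are X 0, X 1, ... *)
Definition walk X (g : word W) (t : T) : path_space W :=
  fun n : nat => g ++ flatten [seq X i t | i <- iota 0 n].

Definition walk_law X (g : word W) : set (path_space W) -> \bar R :=
  pushforward Q (walk X g).

Definition walk_law_mix X m : set (path_space W) -> \bar R :=
  fun A => (\esum_(g in [set: word W]) (m [set g] * walk_law X g A))%E.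

End random_walk.

Section limit.
Context {W : pointedCountType}.

Definition converges_to (x : path_space W) (xi : infinite_words W) : Prop :=
  forall k : nat, \forall n \near \oo, prefix (mkseq xi k) (x n).

Definition limit_map (x : path_space W) : infinite_words W :=
  get [set xi | converges_to x xi].

Definition hitting_measure {R : realType} (P : set (path_space W) -> \bar R) :
    set (infinite_words W) -> \bar R :=
  pushforward P limit_map.

End limit.

Section boundary.
Context {R : realType}.

Definition equal_mod0 d (S : measurableType d) (P : set S -> \bar R)
    (A B : set S) : Prop :=
  P.-negligible (A `+` B).

Definition path_equiv {W : pointedCountType} (x y : path_space W) : Prop :=
  exists i j : nat, forall n : nat, x (n + i)%N = y (n + j)%N.

Definition union_of_classes {W : pointedCountType} (A : set (path_space W)) :
    Prop :=
  forall x y, path_equiv x y -> A x -> A y.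

Definition invariant_algebra {W : pointedCountType}
    (Pm : set (path_space W) -> \bar R) : set (set (path_space W)) :=
  [set A | measurable A /\
     exists B, [/\ measurable B, union_of_classes B & equal_mod0 Pm A B]].

Definition boundary_map {W : pointedCountType}
    (Pm : set (path_space W) -> \bar R)
    d (G : measurableType d) (bnd : path_space W -> G) : Prop :=
  measurable_fun [set: path_space W] bnd /\
  forall A, measurable A ->
    (invariant_algebra Pm A <->
     exists C, measurable C /\ equal_mod0 Pm A (bnd @^-1` C)).

(* Borel isomorphism with a Borel subset of the line. *)
Definition standard_borel d (G : measurableType d) : Prop :=
  exists f : G -> R,
    [/\ measurable_fun [set: G] f, injective f &
        forall A : set G, measurable A -> measurable (f @` A)].

Definition isomorphism_mod0 d1 d2 (S1 : measurableType d1)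
    (S2 : measurableType d2) (nu : set S1 -> \bar R) (la : set S2 -> \bar R)
    (f : S1 -> S2) : Prop :=
  [/\ measurable_fun [set: S1] f,
      forall C, measurable C -> pushforward nu f C = la C &
      exists h : S2 -> S1,
        [/\ measurable_fun [set: S2] h,
            {ae nu, forall x, h (f x) = x} &
            {ae la, forall y, f (h y) = y}]].

(* Points of the Poisson boundary are determined mod 0 only within Lebesgue
   spaces, hence the restriction to standard Borel models G in the second
   clause. The first clause, which needs no model, is the same assertion at the
   level of the sigma-algebra. *)
Definition is_poisson_boundary {W : pointedCountType}
    (Pm P : set (path_space W) -> \bar R) : Prop :=
  (forall A, invariant_algebra Pm A ->
     exists C : set (infinite_words W),
       measurable C /\ equal_mod0 P A (limit_map @^-1` C)) /\
  (forall d (G : measurableType d) (bnd : path_space W -> G),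
     standard_borel G -> boundary_map Pm bnd ->
     exists Lambda : G -> infinite_words W,
       {ae Pm, forall x, Lambda (bnd x) = limit_map x} /\
       isomorphism_mod0 (pushforward P bnd) (hitting_measure P) Lambda).

End boundary.

(* Main.v *)
(** Let [xi] be the limit word and [s_n] the length of [x_n].  Given [xi], the
    position [x_n] is the prefix of [xi] of length [s_n], so only the integers
    [s_n] matter.  Either moment condition gives [H(s_1) < oo]: the entropy
    of the length is at most that of the increment, and an integer with a finite
    logarithmic moment has finite entropy.  A sum of [n] i.i.d. nonnegative
    integers of finite entropy has entropy [o(n)]: the increments below [L] sum to
    at most [n L], and those above [L] carry little entropy each.

    Hence [H(s_n | xi) = o(n)].  The Markov property gives
    [H(s_n | x_1, ..., x_j, xi) = H(s_{n-j} | xi)], so the conditional mutual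
    information of [s_n] and of the first [j] increments given [xi] is
    [H(s_n | xi) - H(s_{n-j} | xi)], which is arbitrarily small for suitable
    arbitrarily large [n].  An invariant event is close both to an event of the
    first [j] increments and, by Markov and invariance, to an event of [x_n] for
    every [n >= j]; being nearly independent of itself given [xi], it is close to
    an event of [xi].  Conditioning on [xi] is replaced throughout by
    conditioning on a long prefix of [xi], so that all variables are discrete. *)

Require Import Defs.
From mathcomp Require Import all_boot all_order all_algebra.
From mathcomp Require Import finmap.
From mathcomp Require Import all_classical all_reals all_analysis.
From mathcomp Require Import measurable_realfun ring lra.

Set Implicit Arguments.
Unset Strict Implicit.
Unset Printing Implicit Defensive.

Import Order.TTheory GRing.Theory Num.Theory.
Import numFieldNormedType.Exports.

Local Open Scope classical_set_scope.
Local Open Scope ring_scope.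

(** * Discrete random variables *)

Section discrete_variables.
Context {d : measure_display} {T : measurableType d}.

(** Under the logarithmic moment an increment may have infinite entropy. Past the initial estimate
    the increments therefore appear only as conditions, and all entropies taken are those of
    lengths, finite in both cases.

    How long the prefix must be depends on [n], and once the first increments are known, with
    product [g], a prefix of length [K] tells only [K - |g|] letters about the walk that remains.
    The comparison at time [n - j] is therefore made with the infimum of the conditional entropy
    over all prefix lengths, a lower bound that this loss does not affect.

    Let [a] be the conditional probability of the event given the prefix. Near independence of the
    two descriptions of the event bounds the mean of [a (1 - a)], so [a] is mostly close to 0 or 1,
    and rounding it yields an event of the prefix.

    The assertion on standard Borel models is pure measure theory: an equality of sigma-algebras mod
    0 becomes a point isomorphism because countably many events separate the points on each side. *)

Definition discrete (I : countType) (f : T -> I) : Prop :=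
  forall i, measurable (f @^-1` [set i]).

Lemma discrete_preimage (I : countType) (f : T -> I) (A : set I) :
  discrete f -> measurable (f @^-1` A).
Proof.
move=> df.
rewrite [X in measurable X](_ : _ =
    \bigcup_i (if i \in A then f @^-1` [set i] else set0)).
  by apply: countable_bigcupT_measurable => // i; case: ifP.
apply/seteqP; split => [t /= At|t [i _]].
  by exists (f t) => //; rewrite mem_set.
by case: ifPn => // /set_mem Ai /= ->.
Qed.

Lemma discrete_comp (I J : countType) (f : T -> I) (g : I -> J) :
  discrete f -> discrete (g \o f).
Proof. by move=> df j; rewrite comp_preimage; exact: discrete_preimage. Qed.

Lemma discrete_pair (I J : countType) (f : T -> I) (g : T -> J) :
  discrete f -> discrete g -> discrete (fun t => (f t, g t)).
Proof.
move=> df dg [i j].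
rewrite [X in measurable X](_ : _ = f @^-1` [set i] `&` g @^-1` [set j]).
  exact: measurableI.
by apply/seteqP; split => t /= [-> ->].
Qed.

Lemma discrete_cst (I : countType) (i : I) : discrete (fun _ : T => i).
Proof.
move=> j; have [->|ij] := eqVneq i j.
  by rewrite [X in measurable X](_ : _ = setT)//; apply/seteqP.
rewrite [X in measurable X](_ : _ = set0)//.
by apply/seteqP; split => // t /= /eqP; rewrite (negbTE ij).
Qed.

Lemma measurable_discrete (I : countType) (f : T -> I)
    d' (Y : measurableType d') (F : Y -> T) :
  discrete f -> measurable_fun setT F -> forall i : I, measurable ((f \o F) @^-1` [set i]).
Proof.
by move=> df mF i; rewrite comp_preimage -[X in measurable X]setTI; exact: mF.
Qed.

End discrete_variables.

Section discrete_integral.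
Context {R : realType} {d : measure_display} {T : measurableType d}.
Local Open Scope ereal_scope.

Lemma measurable_fun_discrete (I : countType) (f : T -> I) (F : I -> \bar R) :
  discrete f -> measurable_fun setT (fun t => F (f t)).
Proof.
move=> df _ B mB; rewrite setTI.
exact: (@discrete_preimage _ _ _ f (F @^-1` B)).
Qed.

(** The codes given by [pickle] enumerate the fibres of [f], which turns the integral into a series
    over [nat]; integers that code nothing give empty fibres, so the series is a sum over [I]. *)
Lemma integral_discrete (mu : {measure set T -> \bar R}) (D : set T)
    (I : countType) (f : T -> I) (F : I -> \bar R) :
  measurable D -> discrete f -> (forall i, 0 <= F i) ->
  \int[mu]_(t in D) F (f t) =
  \esum_(i in [set: I]) (F i * mu (D `&` f @^-1` [set i])).
Proof.
move=> mD df F0.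
pose A n := D `&` (fun t => choice.pickle (f t)) @^-1` [set n].
have mA n : measurable (A n).
  apply: measurableI => //.
  exact: (@discrete_preimage _ _ _ f (choice.pickle @^-1` [set n])).
have UA : \bigcup_n A n = D.
  by apply/seteqP; split => [t [n _ []]//|t Dt]; exists (choice.pickle (f t)).
rewrite -{1}UA ge0_integral_bigcup//; last 2 first.
- rewrite UA; apply: measurable_funTS; exact: measurable_fun_discrete.
- by move=> i j _ _ [t [[/= _ <-] [_ <-]]].
rewrite nneseries_esumT; last by move=> n; exact: integral_ge0.
have E i : \int[mu]_(t in A (choice.pickle i)) F (f t) =
    F i * mu (D `&` f @^-1` [set i]).
  have <- : A (choice.pickle i) = D `&` f @^-1` [set i].
    apply/seteqP; split => t /= [Dt]; last by move=> ft; split; rewrite //= ft.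
    by move=> e; split => //; apply: (pcan_inj (@choice.pickleK I)).
  rewrite -integral_cst//; apply: eq_integral => t; rewrite inE => /= -[_ e].
  by have -> : f t = i by apply: (pcan_inj choice.pickleK).
rewrite -(eq_esum (fun i _ => E i)) -(esum_image setT (@choice.pickle I)
    (fun n => \int[mu]_(t in A n) F (f t))); last first.
  by move=> x y _ _; apply: (pcan_inj choice.pickleK).
rewrite [RHS]esum_mkcond; apply: eq_esum => n _; case: ifPn => //.
rewrite notin_setE => nI; rewrite (_ : A n = set0) ?integral_set0//.
by apply/seteqP; split => // t [_ /= e]; apply: nI; exists (f t).
Qed.

End discrete_integral.

Section law.
Context {R : realType} {d : measure_display} {T : measurableType d}.
Variable Q : probability T R.

Definition law (I : countType) (f : T -> I) (i : I) : R :=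
  fine (Q (f @^-1` [set i])).

Section law_lemmas.
Context {I : countType}.
Variables (f : T -> I) (df : discrete f).

Lemma lawE i : ((law f i)%:E = Q (f @^-1` [set i]))%E.
Proof. by rewrite /law fineK//; exact: fin_num_measure. Qed.

Lemma law_ge0 i : 0 <= law f i.
Proof. exact: fine_ge0. Qed.

Lemma law_le1 i : law f i <= 1.
Proof. by rewrite -lee_fin lawE probability_le1. Qed.

Lemma law_le (J : countType) (g : T -> J) i j : discrete g ->
  (forall t, f t = i -> g t = j) -> law f i <= law g j.
Proof.
move=> dg fg; rewrite -lee_fin lawE /law fineK; last exact: fin_num_measure.
by apply: le_measure; rewrite ?inE//.
Qed.

Local Open Scope ereal_scope.

Lemma integral_law (F : I -> \bar R) : (forall i, 0 <= F i) ->
  \int[Q]_t F (f t) = \esum_(i in [set: I]) (F i * (law f i)%:E).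
Proof.
move=> F0; rewrite integral_discrete//.
by apply: eq_esum => i _; rewrite setTI lawE.
Qed.

(** Null values carry no mass, so a pointwise comparison is needed only where the law is positive.
    There quotients and logarithms of probabilities are genuine, and no almost-everywhere argument
    arises. *)
Lemma le_integral_law (F G : I -> \bar R) :
  (forall i, 0 <= F i) -> (forall i, 0 <= G i) ->
  (forall i, (0 < law f i)%R -> F i <= G i) ->
  \int[Q]_t F (f t) <= \int[Q]_t G (f t).
Proof.
move=> F0 G0 FG; rewrite !integral_law//; apply: le_esum => i _.
have [l0|l0] := ltP 0%R (law f i).
  by rewrite lee_wpmul2r ?lee_fin ?law_ge0// FG.
have -> : law f i = 0%R by apply/eqP; rewrite eq_le l0 law_ge0.
by rewrite !mule0.
Qed.

Lemma eq_integral_law (F G : I -> \bar R) :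
  (forall i, 0 <= F i) -> (forall i, 0 <= G i) ->
  (forall i, (0 < law f i)%R -> F i = G i) ->
  \int[Q]_t F (f t) = \int[Q]_t G (f t).
Proof.
move=> F0 G0 FG; apply/eqP; rewrite eq_le !le_integral_law// => i l0.
  by rewrite FG.
by rewrite FG.
Qed.

Lemma integral_lawD (F G : I -> \bar R) :
  (forall i, 0 <= F i) -> (forall i, 0 <= G i) ->
  \int[Q]_t (F (f t) + G (f t)) = \int[Q]_t F (f t) + \int[Q]_t G (f t).
Proof.
by move=> F0 G0; rewrite ge0_integralD//; exact: measurable_fun_discrete.
Qed.

Lemma probability_preimage (A : set I) :
  Q (f @^-1` A) = \esum_(i in A) (law f i)%:E.
Proof.
have := @integral_law (fun i => (\1_A i)%:E) (fun i => ltac:(by rewrite lee_fin)).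
rewrite [X in X = _ -> _](_ : _ = \int[Q]_t (\1_(f @^-1` A) t)%:E)//.
rewrite integral_indic ?setIT//; last exact: discrete_preimage.
move=> ->; rewrite [RHS]esum_mkcond; apply: eq_esum => i _.
by rewrite indicE; case: ifP => _; rewrite ?mul1e ?mul0e.
Qed.

Lemma esum_law : \esum_(i in [set: I]) (law f i)%:E = 1.
Proof. by rewrite -probability_preimage preimage_setT probability_setT. Qed.

End law_lemmas.

Local Open Scope ereal_scope.

Lemma integral_prob_cst (c : \bar R) : \int[Q]_t cst c t = c.
Proof.
rewrite integral_cst//; rewrite [X in _ * X](_ : _ = 1) ?mule1//.
exact: probability_setT.
Qed.

Lemma esumZl (I : choiceType) (A : set I) (c : R) (a : I -> \bar R) :
  (0 <= c)%R -> (forall i, 0 <= a i) ->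
  \esum_(i in A) (c%:E * a i) = c%:E * \esum_(i in A) a i.
Proof.
move=> c0 a0; rewrite /esum -ereal_supZl//; last first.
  by apply/set0P; exists (\sum_(x \in set0) a x); exists set0 => //; exact: fsets_set0.
congr ereal_sup; apply/seteqP; split => x /=.
  move=> [B BA <-]; exists (\sum_(x \in B) a x); first by exists B.
  by rewrite ge0_mule_fsumr.
by move=> [y [B BA <-] <-]; exists B => //; rewrite ge0_mule_fsumr.
Qed.

Lemma law_marginal (I J : countType) (f : T -> I) (g : T -> J) j :
  discrete f -> discrete g ->
  \esum_(i in [set: I]) (law (fun t => (f t, g t)) (i, j))%:E = (law g j)%:E.
Proof.
move=> df dg; rewrite (lawE dg).
rewrite (_ : g @^-1` [set j] = (fun t => (f t, g t)) @^-1` [set p | p.2 = j])//.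
rewrite (probability_preimage (discrete_pair df dg)).
rewrite (_ : [set p : I * J | p.2 = j] = [set (i, j) | i in [set: I]]).
  by rewrite esum_image// => x y _ _ [].
by apply/seteqP; split => [[i j'] /= ->|_ [i _ <-]//]; exists i.
Qed.

End law.

(** * Conditional entropy *)

Section real_inequalities.
Context {R : realType}.
Implicit Types r t : R.

(** [- ln r] is the integrand of a relative entropy; the correction [r - 1] makes it nonnegative
    pointwise, so that its integral makes sense without any finiteness. *)
Definition entropy_gap r : R := if 0 < r then r - 1 - ln r else 0.

Lemma entropy_gap_ge0 r : 0 <= entropy_gap r.
Proof.
rewrite /entropy_gap; case: ifPn => // r0.
have := @le_ln1Dx R (r - 1); rewrite (_ : 1 + (r - 1) = r); last by ring.
by move=> H; rewrite subr_ge0 H//; lra.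
Qed.

(* Hellinger instead of Pinsker: with [x] the square root of [r],
   [r - 1 - ln r >= (1 - x)^2] and [1 - r <= 2 (1 - x)]. *)
Lemma deficit_le_gap r t : 0 < r -> 0 < t ->
  Num.max (1 - r) 0 <= t + t^-1 * entropy_gap r.
Proof.
move=> r0 t0.
have ti : 0 < t^-1 by rewrite invr_gt0.
have rhs0 : 0 <= t + t^-1 * entropy_gap r.
  by rewrite addr_ge0 ?mulr_ge0 ?entropy_gap_ge0// ltW.
rewrite ge_max rhs0 andbT.
have [r1|r1] := leP 1 r.
  by apply: le_trans rhs0; rewrite subr_le0.
set x := Num.sqrt r.
have x0 : 0 < x by rewrite sqrtr_gt0.
have xr : x ^+ 2 = r by rewrite sqr_sqrtr// ltW.
have x1 : x < 1.
  by rewrite -(@ltr_pXn2r _ 2) ?nnegrE ?(ltW x0) ?ler01// xr expr1n.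
have gx : (1 - x) ^+ 2 <= entropy_gap r.
  rewrite /entropy_gap r0 -xr lnXn// .
  have := @le_ln1Dx R (x - 1); rewrite (_ : 1 + (x - 1) = x); last by ring.
  move=> H; have {}H : ln x <= x - 1 by apply: H; lra.
  by rewrite mulr2n; nra.
apply: (@le_trans _ _ (t + t^-1 * (1 - x) ^+ 2)); last first.
  by rewrite lerD2l ler_wpM2l// ltW.
rewrite -xr -(ler_pM2l t0) [leRHS]mulrDr mulVKf ?gt_eqF//.
have : 0 <= (t - (1 - x)) ^+ 2 by exact: sqr_ge0.
have : 0 <= t * (1 - x) ^+ 2 by rewrite mulr_ge0 ?sqr_ge0// ltW.
lra.
Qed.

End real_inequalities.

Section conditional_entropy.
Context {R : realType} {d : measure_display} {T : measurableType d}.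
Variable Q : probability T R.
Local Open Scope ereal_scope.

(* The conditional entropy [H(U | V)], as the integral of the information
   function; at null values [x / 0 = 0] and [ln 0 = 0] give [0]. *)
Definition condent (I J : countType) (U : T -> I) (V : T -> J) : \bar R :=
  \int[Q]_t
    (ln (law Q V (V t) / law Q (fun s => (U s, V s)) (U t, V t)))%:E.

Lemma ln_law_ge0 (I J : countType) (U : T -> I) (V : T -> J) u v :
  discrete U -> discrete V ->
  (0 <= ln (law Q V v / law Q (fun s => (U s, V s)) (u, v)))%R.
Proof.
move=> dU dV; have [l0|l0] := leP (law Q (fun s => (U s, V s)) (u, v)) 0%R.
  have -> : law Q (fun s => (U s, V s)) (u, v) = 0%R.
    by apply/eqP; rewrite eq_le l0 law_ge0.
  by rewrite invr0 mulr0 ln0.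
apply: ln_ge0; rewrite ler_pdivlMr// mul1r; apply: law_le => //.
- exact: discrete_pair.
- by move=> t [].
Qed.

Lemma condent_ge0 (I J : countType) (U : T -> I) (V : T -> J) :
  discrete U -> discrete V -> 0 <= condent U V.
Proof. by move=> dU dV; apply: integral_ge0 => t _; rewrite lee_fin ln_law_ge0. Qed.

(** Only the partitions matter: the integrand is built from the fibres of [V] and of [(U, V)], so
    [U] has to be matched only inside a fibre of [V]. *)
Lemma eq_condent (I J I' J' : countType) (U : T -> I) (V : T -> J)
    (U' : T -> I') (V' : T -> J') :
  (forall s t, (V s = V t) <-> (V' s = V' t)) ->
  (forall s t, V s = V t -> (U s = U t) <-> (U' s = U' t)) ->
  condent U V = condent U' V'.
Proof.
move=> VV' UU'; apply: eq_integral => t _.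
rewrite /law; congr ((ln (fine (Q _) / fine (Q _)))%:E).
  by apply/seteqP; split => s /= /VV'.
apply/seteqP; split => s /= [e1 e2]; congr (_, _).
- exact: (UU' _ _ e2).1.
- exact: (VV' _ _).1.
- by apply: (UU' _ _ _).2 => //; exact: (VV' _ _).2.
- exact: (VV' _ _).2.
Qed.

Section information.
Context {I I' J : countType}.
Variables (U : T -> I) (U' : T -> I') (V : T -> J).
Hypotheses (dU : discrete U) (dU' : discrete U') (dV : discrete V).

Let W t := (U t, (U' t, V t)).
Let UV t := (U t, V t).
Let U'V t := (U' t, V t).
Let dW : discrete W.
Proof. by do 2?apply: discrete_pair. Qed.
Let dUV : discrete UV. Proof. exact: discrete_pair. Qed.
Let dU'V : discrete U'V. Proof. exact: discrete_pair. Qed.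

(* Density, on the support of the joint law of [(U, U', V)], of the law for which
   [U] and [U'] are independent given [V]. *)
Definition dependence_ratio (w : I * (I' * J)) : R :=
  law Q UV (w.1, w.2.2) * law Q U'V w.2 / (law Q V w.2.2 * law Q W w).

Let r := dependence_ratio.

Let posW w : (0 < law Q W w)%R ->
  [/\ (0 < law Q UV (w.1, w.2.2))%R, (0 < law Q U'V w.2)%R &
      (0 < law Q V w.2.2)%R].
Proof.
case: w => u [u' v] /= l0; split; apply: (lt_le_trans l0); apply: law_le => //.
- by move=> t; rewrite /W /UV => -[-> _ ->].
- by move=> t; rewrite /W /U'V => -[_ -> ->].
- by move=> t; rewrite /W => -[].
Qed.

Lemma dependence_ratio_ge0 w : (0 <= dependence_ratio w)%R.
Proof. by rewrite divr_ge0 ?mulr_ge0 ?law_ge0. Qed.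

Let ratio_gt0 w : (0 < law Q W w)%R -> (0 < r w)%R.
Proof.
by move=> l0; have [? ? ?] := posW l0; rewrite divr_gt0 ?mulr_gt0.
Qed.

(** On the support, the ratio times the joint law is the law of [(U', V)] times the conditional
    probability of [U] given [V]: the value of [U] is resampled. Only an inequality results, since
    what resampling sends off the support is dropped. *)
Lemma integral_dependence_ratio (F : I -> I' -> J -> R) :
  (forall u u' v, 0 <= F u u' v)%R ->
  \int[Q]_t (F (U t) (U' t) (V t) * dependence_ratio (W t))%:E <=
  \int[Q]_t \esum_(u in [set: I])
    (F u (U' t) (V t) * (law Q UV (u, V t) / law Q V (V t)))%:E.
Proof.
move=> F0.
pose c (p : I' * J) u := (F u p.1 p.2 * (law Q UV (u, p.2) / law Q V p.2))%R.
have c0 p u : (0 <= c p u)%R by rewrite mulr_ge0// divr_ge0 ?law_ge0.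
have := @integral_law _ _ _ Q _ _ dU'V
  (fun p => \esum_(u in [set: I]) (c p u)%:E).
rewrite /= => ->; last by move=> p; apply: esum_ge0 => u _; rewrite lee_fin.
have := @integral_law _ _ _ Q _ _ dW
  (fun w => (F w.1 w.2.1 w.2.2 * dependence_ratio w)%:E).
rewrite /= => ->; last by move=> w; rewrite lee_fin mulr_ge0// dependence_ratio_ge0.
rewrite (eq_esum (b := fun p => \esum_(u in [set: I]) (law Q U'V p * c p u)%:E)).
  2: { move=> p _; rewrite muleC -esumZl ?law_ge0// => u.
       by rewrite lee_fin. }
rewrite esum_esum; last by move=> p u _ _; rewrite lee_fin mulr_ge0 ?law_ge0.
rewrite (reindex_esum [set: I * (I' * J)] _ (fun w => (w.2, w.1))); last first.
  split => //; first by move=> [u1 p1] [u2 p2] _ _ [-> ->].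
  by move=> [p u] _; exists (u, p).
apply: le_esum => -[u [u' v]] _ /=.
rewrite -EFinM lee_fin /c /= /dependence_ratio /=.
have [l0|l0] := ltP 0%R (law Q W (u, (u', v))); last first.
  have -> : law Q W (u, (u', v)) = 0%R by apply/eqP; rewrite eq_le l0 law_ge0.
  by rewrite mulr0 !mulr_ge0 ?invr_ge0 ?law_ge0.
have [/= _ _ v0] := posW l0.
rewrite le_eqVlt; apply/orP; left; apply/eqP; field.
by rewrite !gt_eqF.
Qed.

Lemma integral_dependence_ratio_le1 :
  \int[Q]_t (dependence_ratio (W t))%:E <= 1.
Proof.
have := @integral_dependence_ratio (fun _ _ _ => 1%R) (fun _ _ _ => ler01).
under eq_integral do rewrite mul1r.
move=> /le_trans; apply.
have -> : 1 = \int[Q]_t (cst 1%E t) by rewrite integral_prob_cst.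
have := @le_integral_law _ _ _ Q _ _ dV
  (fun v => \esum_(u in [set: I]) (1 * (law Q UV (u, v) / law Q V v))%:E) (cst 1%E).
apply => //; first by move=> v; apply: esum_ge0 => u _; rewrite lee_fin mul1r divr_ge0 ?law_ge0.
move=> v v0; under eq_esum do rewrite mul1r mulrC EFinM.
rewrite esumZl ?invr_ge0 ?law_ge0//; last by move=> u; rewrite lee_fin law_ge0.
by rewrite law_marginal// -EFinM mulVf// gt_eqF.
Qed.

(* The integral of the gap is the conditional mutual information of [U] and [U']
   given [V] (up to the mass lost outside the support). *)
Lemma information_le :
  \int[Q]_t (entropy_gap (dependence_ratio (W t)))%:E +
    condent U (fun t => (U' t, V t)) <= condent U V.
Proof.
pose g w := (entropy_gap (dependence_ratio w))%:E.
pose a w := (ln (law Q U'V w.2 / law Q W w))%:E.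
pose b (w : I * (I' * J)) := (ln (law Q V w.2.2 / law Q UV (w.1, w.2.2)))%:E.
have g0 w : 0 <= g w by rewrite lee_fin entropy_gap_ge0.
have a0 w : 0 <= a w by case: w => u p; rewrite lee_fin ln_law_ge0.
have b0 w : 0 <= b w by rewrite lee_fin ln_law_ge0.
have rr0 w : 0 <= (r w)%:E by rewrite lee_fin dependence_ratio_ge0.
have -> : condent U V = \int[Q]_t b (W t) by [].
have -> : condent U (fun t => (U' t, V t)) = \int[Q]_t a (W t) by [].
have -> : \int[Q]_t (entropy_gap (dependence_ratio (W t)))%:E =
  \int[Q]_t g (W t) by [].
rewrite -(integral_lawD Q dW (F := g) (G := a))//.
(* The extra 1 pays for the term [r - 1] of the gap: on the support [g + a + 1 = b + r], and [r] has
   integral at most 1. All terms stay nonnegative, so infinite entropies need no separate case. *)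
rewrite -(@leeD2rE _ 1)//.
have -> : 1 = \int[Q]_t (cst 1%E t) by rewrite integral_prob_cst.
rewrite -(integral_lawD Q dW (F := fun w => g w + a w) (G := cst 1%E))//; last first.
  by move=> w; rewrite adde_ge0.
apply: (@le_trans _ _ (\int[Q]_t (b (W t) + (r (W t))%:E))).
  apply: (@le_integral_law _ _ _ Q _ _ dW (fun w => g w + a w + 1)
    (fun w => b w + (r w)%:E)) => [w|w|w l0].
  - by rewrite !adde_ge0.
  - by rewrite !adde_ge0.
  have [u0 p0 v0] := posW l0; have rw := ratio_gt0 l0.
  rewrite /g /entropy_gap rw /a /b -!EFinD lee_fin.
  have -> : dependence_ratio w = r w by [].
  have -> : ln (r w) = (ln (law Q UV (w.1, w.2.2)) + ln (law Q U'V w.2) -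
      (ln (law Q V w.2.2) + ln (law Q W w)))%R.
    by rewrite ln_div ?posrE ?mulr_gt0// !lnM ?posrE.
  by rewrite !ln_div ?posrE//; lra.
rewrite (integral_lawD Q dW (F := b) (G := fun w => (r w)%:E))//.
rewrite leeD2l// integral_prob_cst.
exact: integral_dependence_ratio_le1.
Qed.

Lemma condent_le : condent U (fun t => (U' t, V t)) <= condent U V.
Proof.
apply: le_trans information_le; rewrite leeDr//.
by apply: integral_ge0 => t _; rewrite lee_fin entropy_gap_ge0.
Qed.

Lemma integral_deficit_le (s : R) : (0 < s)%R ->
  \int[Q]_t (Num.max (1 - dependence_ratio (W t)) 0)%:E <=
  s%:E + s^-1%:E * \int[Q]_t (entropy_gap (dependence_ratio (W t)))%:E.
Proof.
move=> s0; have si : (0 <= s^-1)%R by rewrite invr_ge0 ltW.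
rewrite -ge0_integralZl//; last 2 first.
- exact: (measurable_fun_discrete (fun w => (entropy_gap (dependence_ratio w))%:E) dW).
- by move=> t _; rewrite lee_fin entropy_gap_ge0.
have -> : s%:E = \int[Q]_t (cst s%:E t).
  by rewrite integral_prob_cst.
have g0 (w : I * (I' * J)) : 0 <= s^-1%:E * (entropy_gap (dependence_ratio w))%:E.
  by rewrite -EFinM lee_fin mulr_ge0// entropy_gap_ge0.
rewrite -(integral_lawD Q dW (F := fun=> s%:E)
  (G := fun w => s^-1%:E * (entropy_gap (dependence_ratio w))%:E)) => //; last first.
  by move=> w; rewrite lee_fin ltW.
apply: (@le_integral_law _ _ _ Q _ _ dW
  (fun w => (Num.max (1 - dependence_ratio w) 0)%:E)
  (fun w => s%:E + s^-1%:E * (entropy_gap (dependence_ratio w))%:E)) => [w|w|w l0].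
- by rewrite lee_fin le_max lexx orbT.
- by rewrite adde_ge0// lee_fin ltW.
- by rewrite -EFinM -EFinD lee_fin deficit_le_gap//; exact: ratio_gt0.
Qed.

End information.

End conditional_entropy.

(** * Events almost determined by a random variable *)

Section conditional_probability.
Context {R : realType} {d : measure_display} {T : measurableType d}.
Variable Q : probability T R.
Local Open Scope ereal_scope.

Definition condprob (J : countType) (E : set T) (V : T -> J) (v : J) : R :=
  (fine (Q (E `&` V @^-1` [set v])) / law Q V v)%R.

Section approximation.
Context {J : countType}.
Variables (V : T -> J) (dV : discrete V).

Lemma condprob_ge0 E v : (0 <= condprob E V v)%R.
Proof. by rewrite divr_ge0 ?law_ge0// fine_ge0. Qed.

Lemma condprob_law E v : measurable E ->
  ((condprob E V v)%:E * (law Q V v)%:E = Q (E `&` V @^-1` [set v])).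
Proof.
move=> mE; have mEV : measurable (E `&` V @^-1` [set v]) by exact: measurableI.
have fEV : Q (E `&` V @^-1` [set v]) \is a fin_num by exact: fin_num_measure.
rewrite -EFinM /condprob; have [l0|l0] := eqVneq (law Q V v) 0%R.
  rewrite l0 mulr0; apply/esym/eqP; rewrite eq_le measure_ge0 andbT.
  by rewrite -l0 lawE// le_measure ?inE//; exact: subIsetr.
by rewrite divfK// fineK.
Qed.

Lemma condprobC E v : measurable E -> (0 < law Q V v)%R ->
  condprob (~` E) V v = (1 - condprob E V v)%R.
Proof.
move=> mE v0; rewrite /condprob -[X in (X - _)%R](@divff _ (law Q V v)) ?gt_eqF//.
rewrite -mulrBl; congr (_ / _)%R.
rewrite [X in (_ = X - _)%R]/law -fineB; [|exact: fin_num_measure|]; last first.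
  by apply: fin_num_measure; exact: measurableI.
rewrite setIC -setDE measureD//; first by rewrite setIC.
by rewrite -ge0_fin_numE//; exact: fin_num_measure.
Qed.

Lemma condprob_le1 E v : measurable E -> (0 < law Q V v)%R ->
  (condprob E V v <= 1)%R.
Proof.
by move=> mE v0; rewrite -subr_ge0 -condprobC// condprob_ge0.
Qed.

Lemma integral_condprob E (F : J -> \bar R) : measurable E ->
  (forall v, 0 <= F v) ->
  \int[Q]_(t in E) F (V t) = \int[Q]_t (F (V t) * (condprob E V (V t))%:E).
Proof.
move=> mE F0; rewrite integral_discrete//.
rewrite (integral_law Q dV (F := fun v => F v * (condprob E V v)%:E)); last first.
  by move=> v; rewrite mule_ge0// lee_fin condprob_ge0.
by apply: eq_esum => v _; rewrite -muleA condprob_law.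
Qed.

Lemma probabilityI_condprob E C : measurable E ->
  Q (E `&` V @^-1` C) = \int[Q]_t ((\1_C (V t))%:E * (condprob E V (V t))%:E).
Proof.
move=> mE; rewrite -(integral_condprob (F := fun v => (\1_C v)%:E))//.
  rewrite [RHS](_ : _ = \int[Q]_(t in E) (\1_(V @^-1` C) t)%:E)//.
  rewrite integral_indic//; first by rewrite setIC.
  exact: discrete_preimage.
Qed.

(** The conditional probability, given [V = v], of the symmetric difference of [E] with the event
    that [V] lies in [C]. *)
Definition condprobY E C v : R :=
  (\1_(~` C) v * condprob E V v + \1_C v * condprob (~` E) V v)%R.

Lemma condprobY_ge0 E C v : (0 <= condprobY E C v)%R.
Proof. by rewrite addr_ge0// mulr_ge0// condprob_ge0. Qed.

Lemma probabilityY_condprob E C : measurable E ->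
  Q (E `+` V @^-1` C) = \int[Q]_t (condprobY E C (V t))%:E.
Proof.
move=> mE; have mC : measurable (V @^-1` C) by exact: discrete_preimage.
have -> : Q (E `+` V @^-1` C) = Q (E `\` V @^-1` C) + Q (V @^-1` C `\` E).
  rewrite measureU//; [exact: measurableD|exact: measurableD|].
  by apply/seteqP; split => // t [[_ ?] []].
have -> : E `\` V @^-1` C = E `&` V @^-1` (~` C) by [].
have -> : V @^-1` C `\` E = ~` E `&` V @^-1` C by rewrite setDE setIC.
rewrite probabilityI_condprob// probabilityI_condprob; last exact: measurableC.
rewrite -(integral_lawD Q dV
  (F := fun v => (\1_(~` C) v)%:E * (condprob E V v)%:E)
  (G := fun v => (\1_C v)%:E * (condprob (~` E) V v)%:E))// => v;
  by rewrite mule_ge0// lee_fin// condprob_ge0.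
Qed.

(* Among the events determined by [V], the one where the conditional
   probability exceeds 1/2 is the closest to [E]. *)
Lemma condprob_half_closest E (a : J -> R) C : measurable E ->
  (forall v, (0 < law Q V v)%R -> a v = condprob E V v) ->
  Q (E `+` V @^-1` [set v | (2^-1 < a v)%R]) <= Q (E `+` V @^-1` C).
Proof.
move=> mE aE; rewrite !probabilityY_condprob//.
set A := [set v | _].
apply: (le_integral_law dV (F := fun v => (condprobY E A v)%:E)
  (G := fun v => (condprobY E C v)%:E)) => [v|v|v v0];
  rewrite lee_fin ?condprobY_ge0//.
rewrite /condprobY condprobC// !indicE !in_setC -aE//.
have -> : (v \in A) = (2^-1 < a v)%R.
  by apply/idP/idP => [/set_mem//|]; exact: mem_set.
case: (v \in C); case: ltP => h; rewrite /= ?mul0r ?mul1r ?add0r ?addr0;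
  move: h; lra.
Qed.

(** Let [a] be the conditional probability of [E] given [V]. Replacing [E'] by [E] on both sides of
    the hypothesis costs the symmetric difference and bounds the mean of [a - a^2]. Rounding [a] at
    1/2 errs with conditional probability [min (a, 1 - a) <= 2 (a - a^2)]. *)
Lemma condprob_approx (E E' : set T) (eta : \bar R) :
  measurable E -> measurable E' -> 0 <= eta ->
  Q (E `&` E') <= \int[Q]_(t in E') (condprob E V (V t))%:E + eta ->
  exists C : set J, Q (E `+` V @^-1` C) <= 2%:E * (eta + Q (E `+` E')).
Proof.
move=> mE mE' eta0 H.
pose a v := condprob E V v.
have a0 v : (0 <= a v)%R by exact: condprob_ge0.
have a0E v : 0 <= (a v)%:E by rewrite lee_fin.
pose b v : R := Num.max (a v - a v ^+ 2)%R 0%R.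
have b0 v : (0 <= b v)%R by rewrite le_max lexx orbT.
have intb : \int[Q]_t (b (V t))%:E <= eta + Q (E `+` E').
  have fa2 : \int[Q]_t (a (V t) ^+ 2)%:E \is a fin_num.
    rewrite ge0_fin_numE; last by apply: integral_ge0 => t _; rewrite lee_fin sqr_ge0.
    apply: (@le_lt_trans _ _ (\int[Q]_t cst 1 t)).
      apply: (le_integral_law dV (F := fun v => (a v ^+ 2)%:E) (G := cst 1)) => //.
        by move=> v; rewrite lee_fin sqr_ge0.
      by move=> v v0; rewrite lee_fin expr_le1// condprob_le1.
    by rewrite integral_prob_cst ltry.
  rewrite -(leeD2rE _ _ fa2).
  rewrite -(integral_lawD Q dV (F := fun v => (b v)%:E)
    (G := fun v => (a v ^+ 2)%:E)) => [||v]; last 2 first.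
  - by move=> v; rewrite lee_fin.
  - by rewrite lee_fin sqr_ge0.
  rewrite (eq_integral_law dV (F := fun v => (b v)%:E + (a v ^+ 2)%:E)
    (G := fun v => (a v)%:E)) => [|v||v v0]; last 3 first.
  - by rewrite -EFinD lee_fin addr_ge0// sqr_ge0.
  - by [].
  - have a1 : (a v <= 1)%R by exact: condprob_le1.
    rewrite -EFinD /b max_l ?subrK// subr_ge0 expr2.
    by rewrite -[leRHS]mulr1 ler_wpM2l.
  have -> : \int[Q]_t (a (V t))%:E = Q E.
    have := @probabilityI_condprob E setT mE.
    rewrite preimage_setT setIT => ->; apply: eq_integral => t _.
    by rewrite indicT mul1e.
  have -> : \int[Q]_t (a (V t) ^+ 2)%:E = \int[Q]_(t in E) (a (V t))%:E.
    rewrite (integral_condprob (F := fun v => (a v)%:E))//.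
  have mEE' : measurable (E `&` E') by exact: measurableI.
  have mD : measurable (E `\` E') by exact: measurableD.
  have mD' : measurable (E' `\` E) by exact: measurableD.
  have QE : Q E = Q (E `&` E') + Q (E `\` E').
    by rewrite addeC -measureDI.
  have QD : Q (E `+` E') = Q (E `\` E') + Q (E' `\` E).
    by rewrite measureU//; apply/seteqP; split => // t [[_ ?] []].
  have IE' : \int[Q]_(t in E') (a (V t))%:E <=
      \int[Q]_(t in E) (a (V t))%:E + Q (E' `\` E).
    have ma : measurable_fun setT (fun t => (a (V t))%:E).
      exact: (measurable_fun_discrete (fun v => (a v)%:E) dV).
    rewrite (_ : E' = (E' `&` E) `|` (E' `\` E)); last by rewrite setUIDK.
    rewrite ge0_integral_setU//; last 3 first.
    - exact: measurableI.
    - exact: measurable_funTS.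
    - by rewrite disj_set_sym; apply/disj_setPS => t [[_ ?] []].
    apply: leeD.
      apply: ge0_subset_integral => //; first exact: measurableI.
      exact: measurable_funTS.
    rewrite (_ : (E' `&` E `|` E' `\` E) `\` E = E' `\` E); last by rewrite setUIDK.
    rewrite -[leRHS]mul1e -integral_cst//.
    rewrite (integral_condprob (F := fun v => (a v)%:E))//.
    rewrite (integral_condprob (F := cst 1))//.
    apply: (le_integral_law dV (F := fun v => (a v)%:E * (condprob _ _ v)%:E)
       (G := fun v => 1 * (condprob (E' `\` E) V v)%:E)) => [v|v|v v0].
    - by rewrite mule_ge0// lee_fin condprob_ge0.
    - by rewrite mul1e lee_fin condprob_ge0.
    - by rewrite lee_wpmul2r ?lee_fin ?condprob_ge0// condprob_le1.
  rewrite QE QD; apply: (le_trans (leeD2r _ (le_trans H (leeD2r _ IE')))).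
  by rewrite [leLHS](ACl (3*(4*2)*1)%AC).
pose C := [set v | (a v > 2^-1)%R].
exists C.
rewrite probabilityY_condprob//.
apply: (@le_trans _ _ (2%:E * \int[Q]_t (b (V t))%:E)); last by rewrite lee_wpmul2l.
rewrite -ge0_integralZl//; last 2 first.
- exact: (measurable_fun_discrete (fun v => (b v)%:E) dV).
- by move=> t _; rewrite lee_fin.
apply: (le_integral_law dV (F := fun v => (condprobY E C v)%:E)
  (G := fun v => 2%:E * (b v)%:E)) => [v|v|v v0].
- by rewrite lee_fin condprobY_ge0.
- by rewrite mule_ge0// lee_fin.
rewrite /condprobY condprobC// -/(a v) /b.
have a1 : (a v <= 1)%R by exact: condprob_le1.
rewrite !indicE in_setC; have -> : (v \in C) = (2^-1 < a v)%R.
  by apply/idP/idP => [/set_mem//|]; exact: mem_set.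
rewrite max_l; last by rewrite subr_ge0 expr2 -[leRHS]mulr1 ler_wpM2l.
have := a0 v; case: ltP => h h0; rewrite /= ?mul0r ?mul1r ?add0r ?addr0 -EFinM lee_fin; nra.
Qed.

End approximation.
End conditional_probability.

Section approximation_by_conditioning.
Context {R : realType} {d : measure_display} {T : measurableType d}.
Variable Q : probability T R.
Context {I I' J : countType}.
Variables (U : T -> I) (U' : T -> I') (V : T -> J).
Hypotheses (dU : discrete U) (dU' : discrete U') (dV : discrete V).
Local Open Scope ereal_scope.

Let W t := (U t, (U' t, V t)).
Let UV t := (U t, V t).
Let dW : discrete W.
Proof. by do 2?apply: discrete_pair. Qed.
Let dUV : discrete UV. Proof. exact: discrete_pair. Qed.

Let E (A : set (I * J)) := UV @^-1` A.
Let mE A : measurable (E A). Proof. exact: discrete_preimage. Qed.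

Lemma esum_condprob (A : set (I * J)) v :
  \esum_(u in [set: I]) (\1_A (u, v) * (law Q UV (u, v) / law Q V v))%:E =
  (condprob Q (E A) V v)%:E.
Proof.
under eq_esum do rewrite mulrA mulrC EFinM.
rewrite esumZl ?invr_ge0 ?law_ge0//; last first.
  by move=> u; rewrite lee_fin mulr_ge0// law_ge0.
rewrite /condprob mulrC EFinM; congr (_ * _).
have -> : E A `&` V @^-1` [set v] = UV @^-1` (A `&` [set p | p.2 = v]) by [].
rewrite fineK; last by apply: fin_num_measure; exact: discrete_preimage.
rewrite (probability_preimage Q dUV).
rewrite (_ : A `&` [set p | p.2 = v] = (fun u => (u, v)) @` [set u | A (u, v)]).
  rewrite esum_image; last by move=> x y _ _ [].
  rewrite [RHS]esum_mkcond; apply: eq_esum => u _.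
  rewrite indicE; have -> : (u \in [set u | A (u, v)]) = ((u, v) \in A).
    by apply/idP/idP; rewrite !inE.
  by case: ifP => _; rewrite ?mul1r ?mul0r ?mulr1 ?mulr0.
by apply/seteqP; split => [[u w] /= [Auw <-]|_ /= [u Au <-]//]; exists u.
Qed.

Lemma probability_conditioning (A : set (I * J)) (D : set I') :
  Q (E A `&` U' @^-1` D) <=
  \int[Q]_(t in U' @^-1` D) (condprob Q (E A) V (V t))%:E +
  \int[Q]_t (Num.max (1 - dependence_ratio Q U U' V (W t))%R 0%R)%:E.
Proof.
pose r := dependence_ratio Q U U' V.
pose S (w : I * (I' * J)) : R := (\1_A (w.1, w.2.2) * \1_D w.2.1)%R.
have S0 w : (0 <= S w)%R by rewrite mulr_ge0.
have r0 w : (0 <= r w)%R by exact: dependence_ratio_ge0.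
have max0 (x : R) : (0 <= Num.max x 0%R)%R by rewrite le_max lexx orbT.
have mD : measurable (U' @^-1` D) by exact: discrete_preimage.
have -> : Q (E A `&` U' @^-1` D) = \int[Q]_t (S (W t))%:E.
  rewrite -[X in Q X]setIT -integral_indic//; last exact: measurableI.
  by apply: eq_integral => t _; rewrite -[in RHS]/(UV t) indicI.
apply: (@le_trans _ _ (\int[Q]_t ((S (W t) * r (W t))%:E +
    (Num.max (1 - r (W t))%R 0%R)%:E))).
  apply: (le_integral_law dW (F := fun w => (S w)%:E) (G := fun w =>
     (S w * r w)%:E + (Num.max (1 - r w)%R 0%R)%:E)) => [w|w|w _].
  - by rewrite lee_fin.
  - by rewrite -EFinD lee_fin addr_ge0// mulr_ge0.
  rewrite -EFinD lee_fin -lerBlDl le_max /S !indicE.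
  case: (_ \in A); case: (_ \in D);
    by rewrite ?(mul1r, mul0r, subr0, lexx, orbT).
rewrite (integral_lawD Q dW (F := fun w => (S w * r w)%:E)
  (G := fun w => (Num.max (1 - r w)%R 0%R)%:E)) => [||w]; last 2 first.
- by move=> w; rewrite lee_fin mulr_ge0.
- by rewrite lee_fin.
apply: leeD => //.
have := @integral_dependence_ratio _ _ _ Q _ _ _ U U' V dU dU' dV
  (fun u u' v => (\1_A (u, v) * \1_D u')%R).
move=> /(_ (fun u u' v => ltac:(by rewrite mulr_ge0))) /le_trans; apply.
rewrite [leRHS]integral_mkcond; apply: ge0_le_integral => //.
- by move=> t _; apply: esum_ge0 => u _; rewrite lee_fin !mulr_ge0// ?invr_ge0 ?law_ge0.
- exact: (measurable_fun_discrete (fun w : I' * J => \esum_(u in [set: I])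
   ((\1_A (u, w.2) * \1_D w.1) * (law Q UV (u, w.2) / law Q V w.2))%:E)
   (discrete_pair dU' dV)).
- apply: (measurable_restrictT _ mD).1; apply: measurable_funTS.
  exact: (measurable_fun_discrete (fun v => (condprob Q (E A) V v)%:E) dV).
move=> t _; rewrite patchE; case: ifPn => tD.
  rewrite -esum_condprob le_eqVlt; apply/orP; left; apply/eqP.
  apply: eq_esum => u _; rewrite [X in (_ * X * _)%R]indicE.
  by rewrite (_ : U' t \in D = true) ?mulr1//; rewrite inE in tD; rewrite mem_set.
rewrite esum1// => u _; rewrite [X in (_ * X * _)%R]indicE.
rewrite (_ : U' t \in D = false) ?mulr0 ?mul0r//.
by apply/negP => /set_mem h; move/negP: tD; apply; rewrite inE.
Qed.

(* A pair [(U, U')] that is almost independent given [V] cannot describe a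
   common event unless that event is almost determined by [V]. *)
Lemma approximation_by_conditioning (A : set (I * J)) (D : set I') (s eta : R) :
  (0 < s)%R -> condent Q U V < +oo ->
  condent Q U V <= condent Q U (fun t => (U' t, V t)) + eta%:E ->
  exists C : set J, Q (E A `+` V @^-1` C) <=
    2%:E * ((s + s^-1 * eta)%:E + Q (E A `+` U' @^-1` D)).
Proof.
move=> s0 fin le_eta.
pose gap := \int[Q]_t (entropy_gap (dependence_ratio Q U U' V (W t)))%:E.
have gap0 : 0 <= gap by apply: integral_ge0 => t _; rewrite lee_fin entropy_gap_ge0.
have dU'V := discrete_pair dU' dV.
have fin' : condent Q U (fun t => (U' t, V t)) \is a fin_num.
  rewrite ge0_fin_numE ?condent_ge0//; apply: le_lt_trans fin; exact: condent_le.
have gap_le : gap <= eta%:E.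
  by rewrite -(leeD2rE _ _ fin') [leRHS]addeC (le_trans _ le_eta)// information_le.
pose mx := \int[Q]_t (Num.max (1 - dependence_ratio Q U U' V (W t))%R 0%R)%:E.
have mx_le : mx <= (s + s^-1 * eta)%:E.
  apply: (le_trans (integral_deficit_le Q dU dU' dV s0)).
  by rewrite EFinD EFinM leeD2l// lee_wpmul2l// lee_fin invr_ge0 ltW.
have [|C HC] := condprob_approx dV (mE A) (discrete_preimage D dU') _
    (probability_conditioning A D).
  by apply: integral_ge0 => t _; rewrite lee_fin le_max lexx orbT.
by exists C; apply: (le_trans HC); rewrite lee_wpmul2l// leeD2r.
Qed.

End approximation_by_conditioning.

(** * Entropy of sums *)

Section entropy.
Context {R : realType} {d : measure_display} {T : measurableType d}.
Variable Q : probability T R.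
Local Open Scope ereal_scope.

Lemma condent_comp_le (I I' J : countType) (U : T -> I) (V : T -> J)
    (g : I -> I') : discrete U -> discrete V ->
  condent Q (g \o U) V <= condent Q U V.
Proof.
move=> dU dV; have dUV := discrete_pair dU dV.
have dgU : discrete (g \o U) by exact: discrete_comp.
apply: (le_integral_law dUV
  (F := fun p => (ln (law Q V p.2 /
     law Q (fun s => ((g \o U) s, V s)) (g p.1, p.2)))%:E)
  (G := fun p => (ln (law Q V p.2 /
     law Q (fun s => (U s, V s)) (p.1, p.2)))%:E)) => [p|p|[u v] l0].
- by rewrite lee_fin ln_law_ge0.
- by rewrite lee_fin ln_law_ge0.
have l1 : (0 < law Q (fun s => ((g \o U) s, V s)) (g u, v))%R.
  apply: (lt_le_trans l0); apply: law_le => //; first exact: discrete_pair.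
  by move=> t [<- <-].
have l2 : (0 < law Q V v)%R.
  by apply: (lt_le_trans l0); apply: law_le => // t [].
rewrite lee_fin /= ler_ln ?posrE ?divr_gt0// ler_pM2l// lef_pV2 ?posrE//.
apply: law_le => //; first exact: discrete_pair.
by move=> t [<- <-].
Qed.

(** The chain rule holds already for the information functions, at every point of positive mass. *)
Lemma condent_pair (I I' J : countType) (U : T -> I) (U' : T -> I')
    (V : T -> J) : discrete U -> discrete U' -> discrete V ->
  condent Q (fun t => (U t, U' t)) V =
  condent Q U (fun t => (U' t, V t)) + condent Q U' V.
Proof.
move=> dU dU' dV; have dU'V := discrete_pair dU' dV.
have dW := discrete_pair dU dU'V.
rewrite -(integral_lawD Q dW (F := fun w => (ln (law Q (fun t => (U' t, V t)) w.2 /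
  law Q (fun t => (U t, (U' t, V t))) w))%:E) (G := fun w => (ln (law Q V w.2.2 /
  law Q (fun t => (U' t, V t)) w.2))%:E)); last 2 first.
- by case=> u p; rewrite lee_fin ln_law_ge0.
- by case=> u [u' v]; rewrite lee_fin ln_law_ge0.
have assoc u u' v : law Q (fun t => ((U t, U' t), V t)) ((u, u'), v) =
    law Q (fun t => (U t, (U' t, V t))) (u, (u', v)).
  rewrite /law; congr (fine (Q _)).
  by apply/seteqP; split => t /= [-> -> ->].
apply: (eq_integral_law dW (F := fun w => (ln (law Q V w.2.2 /
  law Q (fun t => ((U t, U' t), V t)) ((w.1, w.2.1), w.2.2)))%:E)
  (G := fun w => (ln (law Q (fun t => (U' t, V t)) w.2 /
  law Q (fun t => (U t, (U' t, V t))) w))%:E + (ln (law Q V w.2.2 /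
  law Q (fun t => (U' t, V t)) w.2))%:E)) => [[u [u' v]]|[u [u' v]]|[u [u' v]] l0].
- by rewrite lee_fin ln_law_ge0//; exact: discrete_pair.
- by rewrite adde_ge0// lee_fin ln_law_ge0.
have l1 : (0 < law Q (fun t => (U' t, V t)) (u', v))%R.
  by apply: (lt_le_trans l0); apply: law_le => // t [_ -> ->].
have l2 : (0 < law Q V v)%R.
  by apply: (lt_le_trans l0); apply: law_le => // t [].
by rewrite /= assoc -EFinD !ln_div ?posrE//; congr (_%:E); lra.
Qed.

Definition entropy (I : countType) (U : T -> I) : \bar R :=
  condent Q U (fun=> tt).

Lemma entropyE (I : countType) (U : T -> I) : discrete U ->
  entropy U = \esum_(u in [set: I]) ((ln (law Q U u)^-1)%:E * (law Q U u)%:E).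
Proof.
move=> dU.
have l1 : law Q (fun _ : T => tt) tt = 1%R.
  rewrite /law (_ : _ @^-1` _ = setT) ?probability_setT//.
  by apply/seteqP.
have lU u : law Q (fun t => (U t, tt)) (u, tt) = law Q U u.
  rewrite /law; congr (fine (Q _)).
  by apply/seteqP; split => t /= [->].
rewrite -(integral_law Q dU (F := fun u => (ln (law Q U u)^-1)%:E)); last first.
  by move=> u; have := @ln_law_ge0 _ _ _ Q _ _ U _ u tt dU (discrete_cst tt);
    rewrite lU l1 div1r lee_fin.
by apply: eq_integral => t _; rewrite lU l1 div1r.
Qed.

Lemma ln_inv_law_ge0 (I : countType) (U : T -> I) u : discrete U ->
  (0 <= ln (law Q U u)^-1)%R.
Proof.
move=> dU; have [l0|l0] := leP (law Q U u) 0%R.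
  by rewrite ln0// invr_le0.
by rewrite ln_ge0// invf_ge1// law_le1.
Qed.

Lemma entropy_integral (I : countType) (U : T -> I) : discrete U ->
  entropy U = \int[Q]_t (ln (law Q U (U t))^-1)%:E.
Proof.
move=> dU; rewrite entropyE//.
rewrite -(integral_law Q dU (F := fun u => (ln (law Q U u)^-1)%:E))//.
by move=> u; rewrite lee_fin ln_inv_law_ge0.
Qed.

Lemma entropy_comp_le (I I' : countType) (U : T -> I) (g : I -> I') :
  discrete U -> entropy (g \o U) <= entropy U.
Proof. by move=> dU; exact/condent_comp_le/discrete_cst. Qed.

Lemma entropyD_le (U U' : T -> nat) : discrete U -> discrete U' ->
  entropy (fun t => (U t + U' t)%N) <= entropy U + entropy U'.
Proof.
move=> dU dU'; have d1 : discrete (fun _ : T => tt) by exact: discrete_cst.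
apply: (le_trans (entropy_comp_le (fun p : nat * nat => (p.1 + p.2)%N)
  (discrete_pair dU dU'))).
by rewrite /entropy condent_pair// leeD2r// condent_le.
Qed.

Lemma entropy_cst (I : countType) (i : I) : entropy (fun=> i) = 0.
Proof.
rewrite entropy_integral; last exact: discrete_cst.
rewrite integral0_eq// => t _; rewrite /law (_ : _ @^-1` _ = setT); last first.
  by apply/seteqP.
by rewrite probability_setT invr1 ln1.
Qed.

Lemma discrete_sum (Y : nat -> T -> nat) n : (forall i, discrete (Y i)) ->
  discrete (fun t => \sum_(i < n) Y i t)%N.
Proof.
move=> dY; elim: n => [|n IH].
  by rewrite (_ : (fun _ => _) = cst 0%N);
    [exact: discrete_cst|apply/funext => t; rewrite big_ord0].
rewrite (_ : (fun _ => _) = (fun p => p.1 + p.2)%N \o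
    (fun t => (\sum_(i < n) Y i t, Y n t)))%N; last first.
  by apply/funext => t; rewrite /= big_ord_recr.
by apply/discrete_comp/discrete_pair.
Qed.

Lemma entropy_sum_le (Y : nat -> T -> nat) n : (forall i, discrete (Y i)) ->
  entropy (fun t => \sum_(i < n) Y i t)%N <= \sum_(i < n) entropy (Y i).
Proof.
move=> dY; elim: n => [|n IH].
  rewrite big_ord0 (_ : (fun _ => _) = (fun=> 0%N)) ?entropy_cst//.
  by apply/funext => t; rewrite big_ord0.
rewrite big_ord_recr/=; apply: le_trans (leeD2r _ IH).
rewrite (_ : (fun _ => _) = (fun t => \sum_(i < n) Y i t + Y n t)%N).
  by apply: entropyD_le => //; exact: discrete_sum.
by apply/funext => t; rewrite big_ord_recr.
Qed.

Lemma entropy_same_law (I : countType) (U U' : T -> I) :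
  discrete U -> discrete U' -> law Q U =1 law Q U' -> entropy U = entropy U'.
Proof.
by move=> dU dU' UU'; rewrite !entropyE//; apply: eq_esum => u _; rewrite UU'.
Qed.

(** Gibbs' inequality: [- ln x >= 1 - x] at [x = q / law], integrated. As in [information_le], 1 is
    added on both sides to avoid subtractions. *)
Lemma gibbs (I : countType) (U : T -> I) (q : I -> R) : discrete U ->
  (forall u, 0 < q u <= 1)%R -> \esum_(u in [set: I]) (q u)%:E <= 1 ->
  entropy U <= \int[Q]_t (ln (q (U t))^-1)%:E.
Proof.
move=> dU q01 q1; rewrite entropy_integral//.
have q0 u : (0 < q u)%R by case/andP: (q01 u).
have lnq u : (0 <= ln (q u)^-1)%R by rewrite ln_ge0// invf_ge1//; case/andP: (q01 u).
have lnl u := ln_inv_law_ge0 u dU.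
rewrite -(@leeD2rE _ 1)//.
have e1 : 1 = \int[Q]_t (cst 1%E t) by rewrite integral_prob_cst.
rewrite {1}e1 -(integral_lawD Q dU (F := fun u => (ln (law Q U u)^-1)%:E) (G := cst 1))//.
apply: (@le_trans _ _ (\int[Q]_t ((ln (q (U t))^-1)%:E + (q (U t) / law Q U (U t))%:E))).
  apply: (le_integral_law dU (F := fun u => (ln (law Q U u)^-1)%:E + 1)
    (G := fun u => (ln (q u)^-1)%:E + (q u / law Q U u)%:E)) => [u|u|u l0].
  - by rewrite adde_ge0// lee_fin.
  - by rewrite adde_ge0// lee_fin// divr_ge0 ?law_ge0// ltW.
  rewrite -!EFinD lee_fin !lnV ?posrE//.
  have r0 : (0 < q u / law Q U u)%R by rewrite divr_gt0.
  have := @entropy_gap_ge0 R (q u / law Q U u).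
  by rewrite /entropy_gap r0 ln_div ?posrE//; lra.
rewrite (integral_lawD Q dU (F := fun u => (ln (q u)^-1)%:E)
  (G := fun u => (q u / law Q U u)%:E)) => [||u]; last 2 first.
- by move=> u; rewrite lee_fin.
- by rewrite lee_fin divr_ge0 ?law_ge0// ltW.
rewrite leeD2l//; apply: le_trans q1.
rewrite (integral_law Q dU (F := fun u => (q u / law Q U u)%:E)); last first.
  by move=> u; rewrite lee_fin divr_ge0 ?law_ge0// ltW.
apply: le_esum => u _; rewrite -EFinM lee_fin.
have [->|l0] := eqVneq (law Q U u) 0%R; first by rewrite mulr0 ltW.
by rewrite divfK.
Qed.

(* A reference distribution for [gibbs] whose entropy cost is logarithmic. *)
Definition telescoping_weight (k : nat) : R := (k.+1%:R * k.+2%:R)^-1.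

Lemma esum_telescoping_weight :
  \esum_(k in [set: nat]) (telescoping_weight k)%:E <= 1.
Proof.
have w0 k : (0 <= telescoping_weight k)%R by rewrite invr_ge0 mulr_ge0.
rewrite -nneseries_esumT; last by move=> k; rewrite lee_fin.
apply: lime_le; first by apply: is_cvg_nneseries => k _; rewrite lee_fin.
near=> n; rewrite sumEFin lee_fin.
suff -> : (\sum_(0 <= k < n) telescoping_weight k = 1 - n.+1%:R^-1 :> R)%R.
  by rewrite lerBlDr lerDl invr_ge0.
elim: (n) => [|m IH]; first by rewrite big_nil invr1 subrr.
rewrite big_nat_recr//= IH /telescoping_weight.
have m1 : (m.+1%:R != 0 :> R)%R by rewrite pnatr_eq0.
have m2 : (m.+1%:R + 1 != 0 :> R)%R by rewrite natr1 pnatr_eq0.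
have -> : (m.+2%:R = m.+1%:R + 1 :> R)%R by rewrite natr1.
by move: (m.+1%:R : R) m1 m2 => a a1 a2; field; rewrite a1 a2.
Unshelve. all: by end_near.
Qed.

Lemma entropy_le_log (U : T -> nat) : discrete U ->
  entropy U <= \int[Q]_t (ln ((U t).+1%:R * (U t).+2%:R))%:E.
Proof.
move=> dU; have := gibbs (q := telescoping_weight) dU _ esum_telescoping_weight.
under eq_integral do rewrite invrK.
apply=> k; rewrite invr_gt0 invf_le1 ?mulr_gt0//=.
by rewrite -natrM ler1n muln_gt0.
Qed.

End entropy.

(** * Sublinear entropy growth of sums *)

Section entropy_growth.
Context {R : realType}.
Local Open Scope ereal_scope.

Lemma esum_tail (c : nat -> \bar R) (e : R) : (forall k, 0 <= c k) ->
  \esum_(k in [set: nat]) c k < +oo -> (0 < e)%R ->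
  exists L, \esum_(k in [set k | (L < k)%N]) c k <= e%:E.
Proof.
move=> c0 cfin e0.
have /fine_cvgP[_ /cvgrPdist_lt/(_ _ e0)[N _ HN]] :
    \sum_(N <= k <oo) c k @[N --> \oo] --> 0.
  by apply: nneseries_tail_cvg => //; rewrite nneseries_esumT.
exists N; have := HN N.+1 (leqnSn N).
rewrite /= sub0r normrN eseries_cond nneseries_esum// => lt_e.
have s0 : 0 <= \esum_(k in [set k | (N < k)%N]) c k by exact: esum_ge0.
have sfin : \esum_(k in [set k | (N < k)%N]) c k \is a fin_num.
  rewrite ge0_fin_numE//; apply: le_lt_trans cfin.
  by rewrite esum_mkcond; apply: le_esum => k _; case: ifP.
rewrite -(fineK sfin) lee_fin ltW//; apply: le_lt_trans lt_e.
by rewrite ger0_norm// fine_ge0.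
Qed.

Context {d : measure_display} {T : measurableType d}.
Variable Q : probability T R.

(** Values up to [L] are merged into 0, which leaves, for large [L], one heavy atom and a light
    tail. *)
Definition truncated (L k : nat) : nat := if (k <= L)%N then 0%N else k.

(** The tail of the series [c] bounds two things at once: the entropy carried by the values above
    [L], and the mass [1 - p] missing at 0. The latter controls the contribution of the atom 0,
    because [- p ln p <= 1 - p]. *)
Lemma entropy_truncated (Y : T -> nat) (e : R) : discrete Y ->
  entropy Q Y < +oo -> (0 < e)%R ->
  exists L, entropy Q (truncated L \o Y) <= e%:E.
Proof.
move=> dY fin e0; have e2 : (0 < e / 2)%R by rewrite divr_gt0.
pose c k := (ln (law Q Y k)^-1)%:E * (law Q Y k)%:E + (law Q Y k)%:E.
have h0 k : 0 <= (ln (law Q Y k)^-1)%:E * (law Q Y k)%:E.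
  by rewrite mule_ge0// lee_fin ?law_ge0// ln_inv_law_ge0.
have l0 k : 0 <= (law Q Y k)%:E by rewrite lee_fin law_ge0.
have c0 k : 0 <= c k by rewrite adde_ge0.
have [|L HL] := esum_tail c0 _ e2.
  by rewrite esumD// esum_law// -entropyE// lte_add_pinfty// ltry.
exists L; set Z := truncated L \o Y.
have dZ : discrete Z by exact: discrete_comp.
have tail_le (a : nat -> \bar R) : (forall k, a k <= c k) ->
    \esum_(k in [set k | (L < k)%N]) a k <= (e / 2)%:E.
  by move=> ac; apply: le_trans HL; exact: le_esum.
have Z0 : (1 - law Q Z 0%N <= e / 2)%R.
  rewrite -lee_fin; apply: (@le_trans _ _ (Q (Y @^-1` [set k | (L < k)%N]))).
    rewrite EFinB lawE// leeBlDl ?fin_num_measure//.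
    have <- : Q setT = 1 by exact: probability_setT.
    have -> : [set: T] = Z @^-1` [set 0%N] `|` Y @^-1` [set k | (L < k)%N].
      apply/seteqP; split => // t _; rewrite /Z /= /truncated.
      by have [|] := leqP (Y t) L; [left|right].
    by apply: measureU2 => //; exact: discrete_preimage.
  rewrite (probability_preimage Q dY) tail_le// => k.
  by rewrite leeDr.
rewrite entropyE//.
have -> : e%:E = (e / 2)%:E + (e / 2)%:E by rewrite -EFinD; congr (_%:E); lra.
apply: (@le_trans _ _ (\esum_(k in [set: nat]) ((if k == 0%N then (e / 2)%:E else 0) +
   (if (L < k)%N then (ln (law Q Y k)^-1)%:E * (law Q Y k)%:E else 0)))).
  apply: le_esum => k _.
  have [->|k0] := eqVneq k 0%N.
    rewrite ltn0 adde0 -EFinM lee_fin; apply: le_trans Z0.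
    have [z0|z0] := ltP 0%R (law Q Z 0%N); last first.
      have -> : law Q Z 0%N = 0%R by apply/eqP; rewrite eq_le z0 law_ge0.
      by rewrite mulr0 subr0.
    have := @entropy_gap_ge0 R (law Q Z 0%N)^-1; rewrite /entropy_gap invr_gt0 z0.
    rewrite subr_ge0 => lez.
    have := ler_wpM2r (ltW z0) lez.
    by rewrite mulrBl mulVf ?gt_eqF// mul1r.
  rewrite add0e; case: ifPn => Lk.
    have -> : law Q Z k = law Q Y k; last by [].
    rewrite /law; congr (fine (Q _)); apply/seteqP; split => t;
      rewrite /Z /= /truncated; case: ifPn => YL => //.
      by move=> kE; rewrite -kE eqxx in k0.
    by move=> YE; rewrite YE leqNgt Lk in YL.
  have -> : law Q Z k = 0%R; last by rewrite mule0.
  rewrite /law (_ : _ @^-1` _ = set0) ?measure0//.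
  apply/seteqP; split => // t; rewrite /Z /= /truncated; case: ifPn => YL kE.
    by rewrite -kE eqxx in k0.
  by move: YL; rewrite kE -ltnNge (negbTE Lk).
rewrite esumD; last 2 first.
- by move=> k _; case: ifP => // _; rewrite lee_fin ltW.
- by move=> k _; case: ifP.
apply: leeD.
  have -> : (fun k => if k == 0%N then (e / 2)%:E else 0) =
      (fun k => if k \in [set 0%N] then (e / 2)%:E else 0).
    apply/funext => k; congr (if _ then _ else _).
    by apply/idP/idP => [/eqP ->|/set_mem ->//]; rewrite inE.
  by rewrite -esum_mkcond esum_set1// lee_fin ltW.
have -> : (fun k => if (L < k)%N then (ln (law Q Y k)^-1)%:E * (law Q Y k)%:E else 0) =
   (fun k => if k \in [set k | (L < k)%N] then (ln (law Q Y k)^-1)%:E * (law Q Y k)%:E else 0).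
  apply/funext => k; congr (if _ then _ else _).
  by apply/idP/idP => [?|/set_mem//]; rewrite inE.
rewrite -esum_mkcond tail_le// => k.
by rewrite leeDl.
Qed.

(* Increments of size at most [L] contribute at most [n L] in total, which has
   logarithmic entropy; the larger ones have small entropy each. *)
Lemma entropy_sum_sublinear (Y : nat -> T -> nat) (e : R) :
  (forall i, discrete (Y i)) -> (forall i, law Q (Y i) =1 law Q (Y 0%N)) ->
  entropy Q (Y 0%N) < +oo -> (0 < e)%R ->
  exists C : R, forall n,
    entropy Q (fun t => \sum_(i < n) Y i t)%N <= (C + e * n%:R)%:E.
Proof.
move=> dY idY fin e0; have e2 : (0 < e / 2)%R by rewrite divr_gt0.
have [L HL] := entropy_truncated (dY 0%N) fin e2.
pose long i := truncated L \o Y i.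
pose short i t := if (Y i t <= L)%N then Y i t else 0%N.
have dlong i : discrete (long i) by exact: discrete_comp.
have dshort i : discrete (short i).
  exact: (discrete_comp (fun k => if (k <= L)%N then k else 0%N) (dY i)).
have Hlong i : entropy Q (long i) <= (e / 2)%:E.
  rewrite (@entropy_same_law _ _ _ Q _ _ (long 0%N))// => k.
  have E j : law Q (long j) k = fine (\esum_(l in [set l | truncated L l = k]) (law Q (Y j) l)%:E).
    by rewrite -(probability_preimage Q (dY j)).
  by rewrite !E; congr fine; apply: eq_esum => l _; rewrite idY.
have short_le n t : (\sum_(i < n) short i t <= n * L)%N.
  rewrite -[X in (_ <= X * _)%N](card_ord n) -sum_nat_const leq_sum// => i _.
  by rewrite /short; case: ifP.
(* From [ln x <= a x - ln a] at [k + 1] and [k + 2], both at most [n L + 2], the logarithm is at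
   most [2 a n L + 4 a - 2 ln a]. The factor 4 gives [2 a n L <= (e / 2) n]; the other half of [e]
   is left to the long part. *)
pose a : R := (e / (4 * L.+1%:R))%R.
have a0 : (0 < a)%R by rewrite divr_gt0// mulr_gt0.
exists (2 * (2 * a - ln a))%R => n.
have -> : (fun t => \sum_(i < n) Y i t)%N =
    (fun t => \sum_(i < n) short i t + \sum_(i < n) long i t)%N.
  apply/funext => t; rewrite -big_split/=; apply: eq_bigr => i _.
  by rewrite /short /long /= /truncated; case: ifP; rewrite ?addn0.
apply: (le_trans (entropyD_le _ _ _)); [exact: discrete_sum|exact: discrete_sum|].
have -> : (2 * (2 * a - ln a) + e * n%:R =
    (2 * (2 * a - ln a) + e / 2 * n%:R) + n%:R * (e / 2))%R by lra.
rewrite EFinD leeD//; last first.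
  apply: (le_trans (entropy_sum_le _ _ dlong)).
  apply: (@le_trans _ _ (\sum_(i < n) (e / 2)%:E)); first exact: lee_sum.
  by rewrite sumEFin lee_fin sumr_const card_ord mulr_natl.
apply: (le_trans (entropy_le_log Q (discrete_sum n dshort))).
set c := (_ + _)%R.
have ln_le k : (k <= n * L)%N -> (ln (k.+1%:R * k.+2%:R) <= c)%R.
  move=> kn; rewrite lnM ?posrE//.
  have lnx (x : R) : (0 < x -> ln x <= a * x - ln a)%R.
    move=> x0; have ax : (0 < a * x)%R by exact: mulr_gt0.
    have := ltW (ln_sublinear ax); rewrite lnM ?posrE//; lra.
  have kn2 : (k.+2%:R <= n%:R * L%:R + 2 :> R)%R.
    by rewrite -natrM -natrD ler_nat addn2 !ltnS.
  have k12 : (k.+1%:R <= k.+2%:R :> R)%R by rewrite ler_nat.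
  have aL : (4 * (a * L%:R) <= e)%R.
    have aL1 : (a * L.+1%:R = e / 4)%R.
      by rewrite /a invfM mulrA divfK// pnatr_eq0.
    have : (a * L%:R <= a * L.+1%:R)%R by rewrite ler_wpM2l ?ler_nat// ltW.
    rewrite aL1; lra.
  have h1 := lnx _ (ltr0Sn R k); have h2 := lnx _ (ltr0Sn R k.+1).
  have h3 : (a * k.+2%:R <= a * (n%:R * L%:R + 2))%R by rewrite ler_wpM2l// ltW.
  have h4 : (a * k.+1%:R <= a * k.+2%:R)%R by rewrite ler_wpM2l// ltW.
  have h5 : (n%:R * (4 * (a * L%:R)) <= n%:R * e)%R by rewrite ler_wpM2l.
  rewrite /c; lra.
rewrite -[leRHS](integral_prob_cst Q).
apply: (le_integral_law (discrete_sum n dshort)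
  (F := fun k => (ln (k.+1%:R * k.+2%:R))%:E) (G := cst c%:E)) => [k|k|k lk].
- by rewrite lee_fin ln_ge0// -natrM ler1n muln_gt0.
- rewrite lee_fin; apply: le_trans (ln_le 0%N (leq0n _)).
  by rewrite ln_ge0// mul1r ler1n.
rewrite lee_fin ln_le// leqNgt; apply/negP => kn; move: lk.
rewrite /law (_ : _ @^-1` _ = set0) ?measure0 ?ltxx//.
by apply/seteqP; split => // t /= kE; move: kn; rewrite -kE ltnNge short_le.
Qed.

End entropy_growth.

(** * Increments of the random walk *)

Section symmetric_difference.
Context {R : realType} {d : measure_display} {T : measurableType d}.
Variable Q : probability T R.
Local Open Scope ereal_scope.
Implicit Types A B C : set T.

Lemma measurableY A B : measurable A -> measurable B -> measurable (A `+` B).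
Proof. by move=> mA mB; apply: measurableU; exact: measurableD. Qed.

Lemma le_probability A B : measurable A -> measurable B -> A `<=` B -> Q A <= Q B.
Proof. by move=> mA mB AB; rewrite le_measure ?inE. Qed.

Lemma probabilityY_triangle A B C :
  measurable A -> measurable B -> measurable C ->
  Q (A `+` C) <= Q (A `+` B) + Q (B `+` C).
Proof.
move=> mA mB mC; have mAB := measurableY mA mB; have mBC := measurableY mB mC.
apply: le_trans (measureU2 _ mAB mBC).
apply: le_probability; [exact: measurableY|exact: measurableU|].
by move=> t /=; have [?|?] := pselect (B t); tauto.
Qed.

Lemma probabilityYU A B A' B' :
  measurable A -> measurable B -> measurable A' -> measurable B' ->
  Q ((A `|` A') `+` (B `|` B')) <= Q (A `+` B) + Q (A' `+` B').
Proof.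
move=> mA mB mA' mB'; have mAB := measurableY mA mB; have mAB' := measurableY mA' mB'.
apply: le_trans (measureU2 _ mAB mAB').
apply: le_probability; [|exact: measurableU|].
  by apply: measurableY; exact: measurableU.
by move=> t /=; tauto.
Qed.

Lemma setYCC A B : (~` A) `+` (~` B) = A `+` B.
Proof.
apply/seteqP; split => t /=; have [?|?] := pselect (A t);
  have [?|?] := pselect (B t); tauto.
Qed.

End symmetric_difference.

Section increments.
Context {R : realType} {W : pointedCountType}.
Context {d : measure_display} {T : measurableType d} {Q : probability T R}.
Variables (mu : probability (word W) R) (X : nat -> {RV Q >-> word W}).
Hypothesis iidX : iid_with_law mu X.

Definition increments (j : nat) (t : T) : path_space W := fun i => X (j + i)%N t.

Definition first_increments (j : nat) (t : T) : seq (word W) :=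
  [seq X i t | i <- iota 0 j].

Lemma discrete_RV i : discrete (X i).
Proof. by move=> w; rewrite -[X in measurable X]setTI; exact: measurable_funPT. Qed.

Lemma discrete_first_increments j : discrete (first_increments j).
Proof.
elim: j => [|j IH]; first exact: discrete_cst.
rewrite (_ : first_increments _ = (fun p => rcons p.1 p.2) \o
    (fun t => (first_increments j t, X j t))).
  by apply/discrete_comp/discrete_pair => //; exact: discrete_RV.
apply/funext => t.
by rewrite /first_increments -addn1 iotaD map_cat /= cats1.
Qed.

Lemma law_RV i (A : set (word W)) : Q (X i @^-1` A) = mu A.
Proof. by case: iidX => + _; apply. Qed.

Lemma probability_bigcap_RV n (A : nat -> set (word W)) :
  (Q [set t | forall i, (i < n)%N -> A i (X i t)] = \prod_(i < n) mu (A i))%E.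
Proof.
have [_ /(_ [fset i in iota 0 n]%fset A)] := iidX.
rewrite (_ : \bigcap_(i in _) _ = [set t | forall i, (i < n)%N -> A i (X i t)]).
  move=> ->//; rewrite -[RHS](big_mkord xpredT (fun i => mu (A i))) /index_iota subn0.
  rewrite (perm_big (iota 0 n)).
    by apply: eq_bigr => i _; rewrite law_RV.
  by apply: uniq_perm; rewrite ?fset_uniq ?iota_uniq// => i; rewrite !inE.
apply/seteqP; split => t /= H i.
  by move=> ni; apply: H; rewrite /= !inE mem_iota.
by rewrite /= !inE mem_iota add0n => /H.
Qed.

End increments.

(** * The product sigma-algebra of a sequence space *)

Section sequence_space.
Context {S : pointedType}.

Lemma measurable_coordinate (n : nat) (B : set S) :
  measurable [set x : sequence_space S | B (x n)].
Proof. by apply: sub_gen_smallest; exists n, B. Qed.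

(** Sets constraining a single coordinate are not stable under intersection; these rectangles are,
    as the Dynkin argument for independence requires. *)
Definition cylinder_sets : set (set (sequence_space S)) :=
  [set C | exists (n : nat) (A : nat -> set S),
    C = [set x : sequence_space S | forall i, (i < n)%N -> A i (x i)]].

Lemma cylinder_measurable : cylinder_sets `<=` measurable.
Proof.
move=> _ [n [A ->]].
rewrite (_ : mkset _ = \bigcap_i [set x : sequence_space S | (i < n)%N -> A i (x i)]).
  by apply: bigcapT_measurable => i; exact: (measurable_coordinate i [set w | (i < n)%N -> A i w]).
by apply/seteqP; split => x /= h i => [_ /= ni|ni]; apply: h.
Qed.

Lemma measurable_cylinders :
  @measurable _ (sequence_space S) = <<s cylinder_sets >>.
Proof.
apply/seteqP; split; last first.
  apply: smallest_sub; first exact: sigma_algebra_measurable.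
  exact: cylinder_measurable.
apply: smallest_sub; first exact: smallest_sigma_algebra.
move=> _ [n [B ->]]; apply: sub_gen_smallest.
exists n.+1, (fun i => if i == n then B else setT).
apply/seteqP; split => x /=; last by move=> /(_ n (ltnSn n)); rewrite eqxx.
by move=> Bx i _; case: eqP => [->|].
Qed.

Lemma cylinder_setI_closed : setI_closed cylinder_sets.
Proof.
move=> _ _ [n [A ->]] [n' [A' ->]].
exists (n + n')%N, (fun i => [set w | ((i < n)%N -> A i w) /\ ((i < n')%N -> A' i w)]).
apply/seteqP; split => x /=; first by move=> [h h'] i _; split => ni; [exact: h|exact: h'].
move=> h; split => i ni.
  by have [h1 _] := h i (leq_trans ni (leq_addr _ _)); exact: h1.
by have [_ h2] := h i (leq_trans ni (leq_addl _ _)); exact: h2.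
Qed.

Lemma measurable_sequence_map d' (S' : measurableType d')
    (f : S' -> sequence_space S) :
  (forall n B, measurable [set t | B (f t n)]) -> measurable_fun setT f.
Proof.
move=> mf; apply: (@measurability _ _ S' (sequence_space S) setT f (@coordinate_sets S) erefl).
by move=> _ [_ [n [B ->]] <-]; rewrite setTI; exact: mf.
Qed.

End sequence_space.

(** * Independence of past and future increments *)

Section independence.
Context {R : realType} {W : pointedCountType}.
Context {d : measure_display} {T : measurableType d} {Q : probability T R}.
Variables (mu : probability (word W) R) (X : nat -> {RV Q >-> word W}).
Hypothesis iidX : iid_with_law mu X.

Lemma measurable_increments j : measurable_fun setT (increments X j).
Proof.
apply: measurable_sequence_map => n B.
exact: (discrete_preimage (f := X (j + n)%N) B (discrete_RV _ _)).
Qed.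

(** Independence and stationarity in one formula. On a cylinder both sides are products of values of
    [mu], and the sets satisfying the formula form a Dynkin system. *)
Lemma increments_independent j us (E : set (path_space W)) : measurable E ->
  (Q (first_increments X j @^-1` [set us] `&` increments X j @^-1` E) =
   Q (first_increments X j @^-1` [set us]) * Q (increments X 0 @^-1` E))%E.
Proof.
set F := first_increments X j @^-1` [set us].
have mF : measurable F by exact: discrete_first_increments.
have FE : F = [set t | size us = j /\ forall i, (i < j)%N -> X i t = nth [::] us i].
  apply/seteqP; split => t /=; rewrite /F /= /first_increments.
    move=> <-; rewrite size_map size_iota; split => // i ij.
    by rewrite (nth_map 0%N) ?size_iota// nth_iota.
  move=> [sj h]; apply: (@eq_from_nth _ [::]); first by rewrite size_map size_iota.
  move=> i; rewrite size_map size_iota => ij.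
  by rewrite (nth_map 0%N) ?size_iota// nth_iota// h.
have QF : Q F \is a fin_num by exact: fin_num_measure.
have mI k (S : set (path_space W)) : measurable S -> measurable (increments X k @^-1` S).
  by move=> mS; rewrite -[X in measurable X]setTI; exact: measurable_increments.
have finI k (S : set (path_space W)) : measurable S ->
    Q (increments X k @^-1` S) \is a fin_num.
  by move=> mS; apply: fin_num_measure; exact: mI.
rewrite measurable_cylinders.
pose P (S : set (path_space W)) := (Q (F `&` increments X j @^-1` S) =
  Q F * Q (increments X 0 @^-1` S))%E.
apply: (dynkin_induction (P := P) measurable_cylinders cylinder_setI_closed).
- by rewrite /P !preimage_setT setIT probability_setT mule1.
- move=> _ [n [A ->]]; rewrite /P.
  have [sus|sus] := eqVneq (size us) j; last first.
    have -> : F = set0.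
      by apply/seteqP; split => // t; rewrite FE => -[/eqP]; rewrite (negbTE sus).
    by rewrite set0I measure0 mul0e.
  pose C i : set (word W) := if (i < j)%N then [set nth [::] us i] else A (i - j)%N.
  have -> : F = [set t | forall i, (i < j)%N -> [set nth [::] us i] (X i t)].
    by rewrite FE; apply/seteqP; split => t /=; [case|].
  rewrite (_ : _ `&` _ = [set t | forall i, (i < j + n)%N -> C i (X i t)]).
    rewrite (probability_bigcap_RV iidX (j + n) C) big_split_ord/=.
    rewrite (probability_bigcap_RV iidX j (fun i => [set nth [::] us i])).
    rewrite (probability_bigcap_RV iidX n A); congr (_ * _)%E.
      by apply: eq_bigr => i _; rewrite /C ltn_ord.
    by apply: eq_bigr => i _; rewrite /C /= ifN ?addKn// -leqNgt leq_addr.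
  apply/seteqP; split => t /=.
    move=> [h1 h2] i ijn; rewrite /C; case: ltnP => ij; first exact: h1.
    have := h2 (i - j)%N; rewrite /increments subnKC//; apply.
    by rewrite ltn_subLR.
  move=> h; split => [i ij|i ni].
    by have := h i (ltn_addr _ ij); rewrite /C ij.
  by have := h (j + i)%N; rewrite /C ifN ?addKn ?ltn_add2l -?leqNgt ?leq_addr//; apply.
- move=> S mS PS; rewrite /P.
  have pC k : increments X k @^-1` (~` S) = ~` (increments X k @^-1` S) by [].
  rewrite !pC -setDE measureD//; last 2 first.
    exact: mI.
    by rewrite -ge0_fin_numE.
  rewrite [X in (_ - X)%E]PS probability_setC; last exact: mI.
  by rewrite muleBr ?mule1// fin_num_adde_defr// finI.
- move=> G mG tG PG; rewrite /P !preimage_bigcup setI_bigcupr.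
  have tI k : trivIset setT (fun i => increments X k @^-1` G i).
    apply/trivIsetP => i i' _ _ ii'; rewrite -preimage_setI.
    by move/trivIsetP : tG => /(_ i i' Logic.I Logic.I ii') ->; rewrite preimage_set0.
  rewrite measure_bigcup//; last 2 first.
    by move=> i _; apply: measurableI => //; exact: mI.
    exact: trivIset_setIl.
  rewrite measure_bigcup//; last by move=> i _; exact: mI.
  rewrite -(fineK QF) -nneseriesZl//; apply: eq_eseriesr => i _.
  by rewrite (fineK QF); exact: PG.
Qed.

End independence.

(** * Approximation by finitely many increments *)

Section cylinder_approximation.
Context {R : realType} {W : pointedCountType}.
Context {d : measure_display} {T : measurableType d} {Q : probability T R}.
Variable X : nat -> {RV Q >-> word W}.
Local Open Scope ereal_scope.

Lemma first_incrementsE j n t : (j <= n)%N ->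
  first_increments X j t = take j (first_increments X n t).
Proof.
by move=> jn; rewrite /first_increments -map_take take_iota (minn_idPl jn).
Qed.

Lemma nth_first_increments j i t : (i < j)%N ->
  nth [::] (first_increments X j t) i = X i t.
Proof.
by move=> ij; rewrite (nth_map 0%N) ?size_iota// nth_iota.
Qed.

Lemma measurable_increments_preimage j (S : set (path_space W)) :
  measurable S -> measurable (increments X j @^-1` S).
Proof.
by move=> mS; rewrite -[X in measurable X]setTI; exact: measurable_increments.
Qed.

Lemma measurable_first_preimage j (D : set (seq (word W))) :
  measurable (first_increments X j @^-1` D).
Proof. exact/discrete_preimage/discrete_first_increments. Qed.

(** The approximable events form a sigma-algebra containing the coordinate sets. Countable unions
    reduce to finite ones by continuity from below, and two events are united inside a common longer
    block of increments. *)
Lemma cylinder_approximation (E : set (path_space W)) (e : R) :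
  measurable E -> (0 < e)%R ->
  exists (j : nat) (D : set (seq (word W))),
    Q (increments X 0 @^-1` E `+` first_increments X j @^-1` D) <= e%:E.
Proof.
have mI := @measurable_increments_preimage 0.
have mF := measurable_first_preimage.
pose S : set (set (path_space W)) := [set E | measurable E /\
  forall e : R, (0 < e)%R -> exists (j : nat) (D : set (seq (word W))),
    Q (increments X 0 @^-1` E `+` first_increments X j @^-1` D) <= e%:E].
suff : @measurable _ (path_space W) `<=` S.
  by move=> mS mE; have [_ h] := mS _ mE; exact: h.
have SU A B : S A -> S B -> S (A `|` B).
  move=> [mA hA] [mB hB]; split => [|r r0]; first exact: measurableU.
  have r2 : (0 < r / 2)%R by rewrite divr_gt0.
  have [j [D hD]] := hA _ r2; have [j' [D' hD']] := hB _ r2.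
  exists (j + j')%N, [set us | D (take j us) \/ D' (take j' us)].
  rewrite preimage_setU.
  rewrite (_ : first_increments X (j + j') @^-1` _ =
    first_increments X j @^-1` D `|` first_increments X j' @^-1` D').
    apply: le_trans (probabilityYU Q (mI _ mA) (mF _ _) (mI _ mB) (mF _ _)) _.
    by apply: (le_trans (leeD hD hD')); rewrite -EFinD lee_fin; lra.
  by apply/seteqP; split => t /=; rewrite -!first_incrementsE ?leq_addr ?leq_addl.
apply: smallest_sub; first split.
- split => // r r0; exists 0%N, set0.
  by rewrite !preimage_set0 setYK measure0 lee_fin ltW.
- move=> A [mA hA]; split => [|r r0]; first by apply: measurableD.
  have [j [D hD]] := hA _ r0; exists j, (~` D).
  by rewrite setTD -[X in Q (X `+` _)]/(~` _) -[X in Q (_ `+` X)]/(~` _) setYCC.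
- move=> A SA; split; first by apply: bigcupT_measurable => i; have [] := SA i.
  move=> r r0; have r2 : (0 < r / 2)%R by rewrite divr_gt0.
  pose B n := \bigcup_(k < n) A k.
  have SB n : S (B n).
    rewrite /B; elim: n => [|n IH].
      rewrite bigcup_mkord big_ord0; split => // s s0; exists 0%N, set0.
      by rewrite !preimage_set0 setYK measure0 lee_fin ltW.
    by rewrite bigcup_mkord big_ord_recr/= -bigcup_mkord; exact: SU.
  pose I := increments X 0.
  have mIB n : measurable (I @^-1` B n) by apply: mI; have [] := SB n.
  have mIA : measurable (I @^-1` \bigcup_n A n).
    by apply/mI/bigcupT_measurable => i; have [] := SA i.
  have UB : \bigcup_n (I @^-1` B n) = I @^-1` \bigcup_n A n.
    apply/seteqP; split => t /=; first by move=> [n _ [k _ ?]]; exists k.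
    by move=> [k _ ?]; exists k.+1 => //; exists k => //=.
  have ndB : nondecreasing_seq (fun n => I @^-1` B n).
    move=> n m nm; apply/subsetPset => t [k /= kn ?].
    by exists k => //=; rewrite (leq_trans kn).
  have cvgB := nondecreasing_cvg_mu (mu := Q) mIB (eq_ind_r measurable mIA UB) ndB.
  rewrite UB in cvgB.
  have finIA : Q (I @^-1` \bigcup_n A n) \is a fin_num by exact: fin_num_measure.
  have [n hn] : exists n, Q (I @^-1` \bigcup_n A n) - (r / 2)%:E <= Q (I @^-1` B n).
    have : Q (I @^-1` B n) @[n --> \oo] --> (fine (Q (I @^-1` \bigcup_n A n)))%:E.
      by rewrite fineK.
    move=> /fine_cvgP[_ /cvgrPdist_le/(_ _ r2)[n _ hn]].
    have {}hn := hn n (leqnn n).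
    exists n; rewrite -(fineK finIA) -(@fineK _ (Q (I @^-1` B n))) ?fin_num_measure//.
    rewrite -EFinB lee_fin lerBlDr -lerBlDl.
    exact: le_trans (ler_norm _) hn.
  have [mB hB] := SB n; have [j [D hD]] := hB _ r2.
  exists j, D.
  apply: (le_trans (probabilityY_triangle Q mIA (mIB n) (mF _ _))).
  have -> : r%:E = (r / 2)%:E + (r / 2)%:E by rewrite -EFinD; congr (_%:E); lra.
  apply: leeD => //.
  have sub : I @^-1` B n `<=` I @^-1` \bigcup_n A n by move=> t [k _ ?]; exists k.
  rewrite /setY (_ : I @^-1` B n `\` _ = set0) ?setU0.
    rewrite measureD//; last by rewrite -ge0_fin_numE.
    rewrite setIidr// leeBlDr ?fin_num_measure//.
    by rewrite addeC -leeBlDr.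
  by apply/seteqP; split => // t [/sub].
- move=> _ [n [B ->]]; split; first exact: measurable_coordinate.
  move=> r r0; exists n.+1, [set us | B (nth [::] us n)].
  rewrite (_ : _ @^-1` _ = first_increments X n.+1 @^-1` [set us | B (nth [::] us n)]).
    by rewrite setYK measure0 lee_fin ltW.
  by apply/seteqP; split => t /=; rewrite nth_first_increments.
Qed.

End cylinder_approximation.

(** * Limits of walks on words *)

Section limits_of_walks.
Context {W : pointedCountType}.
Implicit Types (x y : path_space W) (g : word W) (xi : infinite_words W).

(** The walk as a function of its increments alone, so that convergence is treated path by path and
    any start [g] can be combined with any increments. *)
Definition word_walk g y : path_space W :=
  fun n => g ++ flatten [seq y i | i <- iota 0 n].

Definition escaping y : Prop :=
  forall N, exists i, (N <= i)%N /\ y i != [::].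

Lemma word_walkD g y j n :
  word_walk g y (j + n) =
  word_walk (g ++ flatten [seq y i | i <- iota 0 j]) (fun i => y (j + i)%N) n.
Proof.
rewrite /word_walk iotaD map_cat flatten_cat catA; congr (_ ++ flatten _).
by rewrite add0n -[X in iota X]addn0 iotaDl -map_comp.
Qed.

Lemma word_walk_prefix g y n m : (n <= m)%N ->
  prefix (word_walk g y n) (word_walk g y m).
Proof.
move=> /subnKC <-; rewrite /word_walk iotaD map_cat flatten_cat catA.
exact: prefix_prefix.
Qed.

Lemma escaping_shift y j : escaping y <-> escaping (fun i => y (j + i)%N).
Proof.
split => esc N.
  have [i [Ni yi]] := esc (j + N)%N; exists (i - j)%N.
  have ji : (j <= i)%N by rewrite (leq_trans _ Ni)// leq_addr.
  by rewrite subnKC// leq_subRL.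
have [i [Ni yi]] := esc N; exists (j + i)%N; split => //.
by rewrite (leq_trans Ni)// leq_addl.
Qed.

Lemma escaping_unbounded g y K : escaping y -> exists n, (K < size (word_walk g y n))%N.
Proof.
move=> esc; elim: K => [|K [n Kn]].
  have [i [_ yi]] := esc 0%N; exists i.+1.
  rewrite /word_walk -(addn1 i) iotaD map_cat flatten_cat /= cats0 !size_cat.
  by rewrite -size_eq0 -lt0n in yi; rewrite !addn_gt0 yi !orbT.
have [i [ni yi]] := esc n; exists i.+1.
rewrite /word_walk -(addn1 i) iotaD map_cat flatten_cat /= cats0 catA.
apply: (@leq_trans (K.+1 + 1)); first by rewrite addn1.
rewrite size_cat leq_add//; last first.
  by rewrite lt0n size_eq0.
exact: leq_trans Kn (size_prefix (word_walk_prefix g y ni)).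
Qed.

Lemma prefix_eq (s t u : word W) : prefix s u -> prefix t u -> size s = size t -> s = t.
Proof. by rewrite !prefixE => /eqP es /eqP et st; rewrite -es -et st. Qed.

Lemma converges_unique x xi xi' :
  converges_to x xi -> converges_to x xi' -> xi = xi'.
Proof.
move=> cx cx'; apply/funext => k.
have [n [h h']] : exists n, prefix (mkseq xi k.+1) (x n) /\ prefix (mkseq xi' k.+1) (x n).
  have [N _ hN] := cx k.+1; have [N' _ hN'] := cx' k.+1.
  exists (N + N')%N; split; first by apply: hN; exact: leq_addr.
  by apply: hN'; exact: leq_addl.
have e : mkseq xi k.+1 = mkseq xi' k.+1 by apply: (prefix_eq h h'); rewrite !size_mkseq.
have /(congr1 (fun s => nth point s k)) := e.
by rewrite !nth_mkseq.
Qed.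

Lemma limit_mapE x xi : converges_to x xi -> limit_map x = xi.
Proof.
move=> cx; apply: (@converges_unique x) => //; rewrite /limit_map.
by apply: (@getPex _ [set xi | converges_to x xi]); exists xi.
Qed.

(** Each position extends the earlier ones, so letter [k] of the limit can be read at any time when
    the position is longer than [k]. *)
Lemma word_walk_converges g y : escaping y ->
  converges_to (word_walk g y) (limit_map (word_walk g y)).
Proof.
move=> esc; set x := word_walk g y.
suff [xi cx] : exists xi, converges_to x xi by rewrite (limit_mapE cx).
pose n k := projT1 (cid (escaping_unbounded g k esc)).
have nP k : (k < size (x (n k)))%N by exact: projT2 (cid (escaping_unbounded g k esc)).
exists (fun k => nth point (x (n k)) k) => k.
(* The sum only serves as a common upper bound of the times [n i] with [i < k]. *)
exists (\sum_(i < k) n i)%N => // m /= km.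
have ik i : (i < k)%N -> prefix (x (n i)) (x m).
  move=> ik; apply: word_walk_prefix; apply: leq_trans km.
  by rewrite (bigD1 (Ordinal ik))//= leq_addr.
have kx : (k <= size (x m))%N.
  case: k km ik => // k km ik.
  exact: leq_trans (nP k) (size_prefix (ik _ (ltnSn k))).
rewrite prefixE size_mkseq; apply/eqP.
apply: (@eq_from_nth _ point); rewrite size_takel// ?size_mkseq// => i ltik.
rewrite nth_take// nth_mkseq//.
have := ik i ltik; rewrite prefixE => /eqP <-.
by rewrite nth_take.
Qed.

Lemma word_walkE g y n : escaping y ->
  word_walk g y n = mkseq (limit_map (word_walk g y)) (size (word_walk g y n)).
Proof.
move=> esc; have [N _ hN] := word_walk_converges g esc (size (word_walk g y n)).
apply: (@prefix_eq _ _ (word_walk g y (n + N))); last by rewrite size_mkseq.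
  by apply: word_walk_prefix; exact: leq_addr.
by apply: hN; exact: leq_addl.
Qed.

Lemma limit_word_walk_cat g y K : escaping y ->
  mkseq (limit_map (word_walk g y)) (size g + K) =
  g ++ mkseq (limit_map (word_walk [::] y)) K.
Proof.
move=> esc; have [N _ hN] := word_walk_converges g esc (size g + K)%N.
have [N' _ hN'] := word_walk_converges [::] esc K.
apply: (@prefix_eq _ _ (word_walk g y (N + N'))).
- by apply: hN; exact: leq_addr.
- have := hN' _ (leq_addl N N'); rewrite !prefixE => /eqP h.
  by rewrite size_cat takeD take_size_cat// drop_size_cat// h eqxx.
- by rewrite size_cat !size_mkseq.
Qed.

Lemma converges_to_shift x j xi :
  converges_to (fun n => x (j + n)%N) xi <-> converges_to x xi.
Proof.
split => cx k; have [N _ hN] := cx k.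
  exists (j + N)%N => // n /= jn.
  have jn' : (j <= n)%N by rewrite (leq_trans _ jn)// leq_addr.
  by have := hN (n - j)%N; rewrite /= subnKC//; apply; rewrite leq_subRL.
by exists N => // n /= Nn; apply: hN; rewrite /= (leq_trans Nn)// leq_addl.
Qed.

Lemma limit_map_shift x j : limit_map (fun n => x (j + n)%N) = limit_map x.
Proof.
rewrite /limit_map; congr get; apply/seteqP; split => xi /=;
  by rewrite converges_to_shift.
Qed.

(* [None] off the escaping sequences makes [limit_prefix_fiber] and
   [limit_prefix_coarse] hold everywhere and not only almost everywhere. *)
Definition limit_prefix g K y : option (word W) :=
  if `[< escaping y >] then Some (mkseq (limit_map (word_walk g y)) K) else None.

Lemma limit_prefix_shift g K y j :
  limit_prefix g K y =
  limit_prefix (g ++ flatten [seq y i | i <- iota 0 j]) K (fun i => y (j + i)%N).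
Proof.
rewrite /limit_prefix (propext (escaping_shift y j)); case: ifP => // _.
rewrite -(limit_map_shift (word_walk g y) j); congr (Some (mkseq (limit_map _) _)).
by apply/funext => n; rewrite word_walkD.
Qed.

(** A known word [g] in front adds no information: what remains are [K - |g|] letters of the limit
    started at the empty word. When [g] is longer than [K], truncated subtraction gives the empty
    prefix, and both sides only tell whether the sequence escapes. *)
Lemma limit_prefix_fiber g K y y' :
  limit_prefix g K y = limit_prefix g K y' <->
  limit_prefix [::] (K - size g) y = limit_prefix [::] (K - size g) y'.
Proof.
rewrite /limit_prefix; case: asboolP => esc; case: asboolP => esc' //.
have take_mk (xi : infinite_words W) n m : (n <= m)%N -> mkseq xi n = take n (mkseq xi m).
  by move=> nm; rewrite -map_take take_iota (minn_idPl nm).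
have le : (K <= size g + (K - size g))%N by rewrite -leq_subLR.
rewrite (take_mk (limit_map (word_walk g y)) _ _ le).
rewrite (take_mk (limit_map (word_walk g y')) _ _ le).
rewrite (limit_word_walk_cat g _ esc) (limit_word_walk_cat g _ esc').
have [gK|Kg] := leqP (size g) K.
  rewrite !take_oversize ?size_cat ?size_mkseq ?subnKC//.
  by split => -[/eqP]; [rewrite eqseq_cat// => /andP[_ /eqP ->]|move=> /eqP ->].
have -> : (K - size g = 0)%N by apply/eqP; rewrite subn_eq0 ltnW.
by split.
Qed.

Lemma limit_prefix_coarse K K' y y' : (K' <= K)%N ->
  limit_prefix [::] K y = limit_prefix [::] K y' ->
  limit_prefix [::] K' y = limit_prefix [::] K' y'.
Proof.
move=> KK; rewrite /limit_prefix; case: asboolP => esc; case: asboolP => esc' //.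
move=> [] /(congr1 (take K')).
by rewrite /mkseq -!map_take take_iota (minn_idPl KK) => ->.
Qed.

End limits_of_walks.

(** * Measurability of the limit *)

Section measurability_of_limits.
Context {W : pointedCountType}.

Lemma discrete_coordinate (S : pointedCountType) (n : nat) :
  discrete (fun x : sequence_space S => x n).
Proof. by move=> w; exact: (measurable_coordinate n [set w]). Qed.

Lemma discrete_word_coordinate (n : nat) :
  discrete (fun x : path_space W => x n).
Proof. by move=> w; exact: (measurable_coordinate n [set w]). Qed.

Lemma discrete_mkseq n : discrete (fun xi : infinite_words W => mkseq xi n).
Proof.
elim: n => [|n IH]; first exact: discrete_cst.
rewrite (_ : (fun _ => _) = (fun p => rcons p.1 p.2) \o
    (fun xi : infinite_words W => (mkseq xi n, xi n))); last first.
  by apply/funext => xi; rewrite /mkseq -addn1 iotaD map_cat /= cats1.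
by apply/discrete_comp/discrete_pair => //; exact: discrete_coordinate.
Qed.

Lemma discrete_word_walk g n : discrete (fun y : path_space W => word_walk g y n).
Proof.
elim: n => [|n IH].
  by rewrite (_ : (fun _ => _) = (fun=> g ++ [::])); [exact: discrete_cst|].
rewrite (_ : (fun _ => _) = (fun p => p.1 ++ p.2) \o
    (fun y : path_space W => (word_walk g y n, y n))); last first.
  apply/funext => y.
  by rewrite /word_walk -(addn1 n) iotaD map_cat flatten_cat /= cats0 catA.
by apply/discrete_comp/discrete_pair => //; exact: discrete_word_coordinate.
Qed.

Lemma measurable_word_walk g :
  measurable_fun setT (word_walk g : path_space W -> path_space W).
Proof.
apply: (@measurable_sequence_map (word W) _ (path_space W)) => n B.
exact: (discrete_preimage B (@discrete_word_walk g n)).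
Qed.

Lemma measurable_escaping : measurable [set y : path_space W | escaping y].
Proof.
rewrite (_ : mkset _ = \bigcap_N \bigcup_(i in [set i | (N <= i)%N])
    [set y : path_space W | [set~ [::]] (y i)]).
  apply: bigcapT_measurable => N; apply: bigcup_measurable => i _.
  exact: (@measurable_coordinate (word W) i [set~ [::]]).
apply/seteqP; split => y /=.
  by move=> esc N _; have [i [Ni /eqP yi]] := esc N; exists i.
by move=> h N; have [i Ni yi] := h N Logic.I; exists i; split => //; exact/eqP.
Qed.

Let settles k w (x : path_space W) : Prop :=
  exists N, forall n, (N <= n)%N -> (k < size (x n))%N /\ nth point (x n) k = w.

Let measurable_settles k w : measurable [set x | settles k w x].
Proof.
rewrite (_ : mkset _ = \bigcup_N \bigcap_n [set x : path_space W |
    [set u | (N <= n)%N -> (k < size u)%N /\ nth point u k = w] (x n)]).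
  apply: bigcupT_measurable => N; apply: bigcapT_measurable => n.
  exact: (@measurable_coordinate (word W) n
    [set u | (N <= n)%N -> (k < size u)%N /\ nth point u k = w]).
apply/seteqP; split => x /=; first by move=> [N hN]; exists N => // n _; exact: hN.
by move=> [N _ hN]; exists N => n; exact: (hN n Logic.I).
Qed.

Let converges_settles x xi k : converges_to x xi -> settles k (xi k) x.
Proof.
move=> /(_ k.+1)[N _ hN]; exists N => n Nn.
have := hN n Nn; rewrite /= prefixE size_mkseq => /eqP h.
have ks : (k < size (x n))%N.
  by have := size_mkseq xi k.+1; rewrite -h size_take; case: ltnP => [/ltnW//|_ ->].
by split => //; rewrite -(@nth_take k.+1)// h nth_mkseq.
Qed.

Let settles_unique k w w' x : settles k w x -> settles k w' x -> w = w'.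
Proof.
move=> [N hN] [N' hN'].
by have [_ <-] := hN (N + N')%N (leq_addr _ _); have [_ <-] := hN' (N + N')%N (leq_addl _ _).
Qed.

Let settles_converges x : (forall k, exists w, settles k w x) ->
  exists xi, converges_to x xi.
Proof.
move=> sx; pose xi k := projT1 (cid (sx k)).
have xiP k : settles k (xi k) x := projT2 (cid (sx k)).
exists xi => k; pose n i := projT1 (cid (xiP i)).
have nP i := projT2 (cid (xiP i)).
exists (\sum_(i < k) n i)%N => // m /= km.
have ik i : (i < k)%N -> (i < size (x m))%N /\ nth point (x m) i = xi i.
  move=> ik; apply: nP; apply: leq_trans km.
  by rewrite (bigD1 (Ordinal ik))//= leq_addr.
have kx : (k <= size (x m))%N.
  by case: k {km} ik => // k ik; have [] := ik k (ltnSn k).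
rewrite prefixE size_mkseq; apply/eqP.
apply: (@eq_from_nth _ point); rewrite size_takel// ?size_mkseq// => i ltik.
by rewrite nth_take// nth_mkseq//; have [] := ik i ltik.
Qed.

(** That a letter settles is an event of eventual constancy, expressed by countably many
    coordinates, and convergence means that every letter settles. On the remaining paths [get] of
    the empty set is the constant [point]. *)
Lemma measurable_limit_map :
  measurable_fun setT (limit_map : path_space W -> infinite_words W).
Proof.
apply: (@measurable_sequence_map W _ (path_space W)) => k B.
pose conv := \bigcap_k \bigcup_w [set x | settles k w x].
have cW : countable [set: W] by exact: (@countableP (Countable.clone W _) setT).
have mconv : measurable conv.
  apply: bigcapT_measurable => i; apply: (countable_bigcupT_measurable cW) => w.
  exact: measurable_settles.
have convP x : conv x <-> exists xi, converges_to x xi.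
  split => [h|[xi cx] i _].
    by apply: settles_converges => i; have [w _ sw] := h i Logic.I; exists w.
  by exists (xi i) => //; exact: converges_settles.
rewrite (_ : mkset _ = (conv `&` \bigcup_w (if `[< B w >] then [set x | settles k w x] else set0))
   `|` (if `[< B ((point : infinite_words W) k) >] then ~` conv else set0)).
  apply: measurableU.
    apply: measurableI => //; apply: (countable_bigcupT_measurable cW) => w.
    by case: ifP.
  by case: ifP => // _; exact: measurableC.
apply/seteqP; split => x /=.
  have [cx|ncx] := pselect (conv x).
    have [xi xxi] := (convP x).1 cx; rewrite (limit_mapE xxi) => Bx; left; split => //.
    by exists (xi k) => //; rewrite asboolT//; exact: converges_settles.
  have -> : limit_map x = point.
    by apply: xgetPN => xi cx; apply: ncx; apply/convP; exists xi.
  by move=> Bp; right; rewrite asboolT.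
move=> [[cx [w _]]|].
  have [xi xxi] := (convP x).1 cx; rewrite (limit_mapE xxi).
  case: asboolP => // Bw sw.
  by rewrite (settles_unique (converges_settles k xxi) sw).
case: asboolP => // Bp ncx.
have -> : limit_map x = point.
  by apply: xgetPN => xi cx; apply: ncx; apply/convP; exists xi.
by [].
Qed.

Lemma discrete_limit_prefix g K :
  discrete (limit_prefix g K : path_space W -> option (word W)).
Proof.
have mwalk : discrete (fun y : path_space W => mkseq (limit_map (word_walk g y)) K).
  apply: (measurable_discrete (@discrete_mkseq K)).
  exact: measurableT_comp measurable_limit_map (measurable_word_walk g).
have mesc := measurable_escaping.
case=> [z|].
  rewrite (_ : _ @^-1` _ = [set y : path_space W | escaping y] `&`
      (fun y : path_space W => mkseq (limit_map (word_walk g y)) K) @^-1` [set z]).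
    exact: measurableI.
  apply/seteqP; split => y; rewrite /limit_prefix /=; case: asboolP => // esc.
  - by move=> [].
  - by move=> [_ ->].
  - by move=> [].
rewrite (_ : _ @^-1` _ = ~` [set y : path_space W | escaping y]).
  exact: measurableC.
by apply/seteqP; split => y; rewrite /limit_prefix /=; case: asboolP.
Qed.

End measurability_of_limits.

(** * The position of the walk given its limit *)

(** Were there no such [n], [a] would gain at least [e] over every [j] steps, so [a (k j) >= k e];
    the slope [e / (2 (j + 1))] allows at most [C + k e / 2], which is smaller for large [k]. The
    [j + 1] keeps the slope meaningful at [j = 0]. *)
Lemma sublinear_increment {R : realType} (a : nat -> R) (j : nat) (e : R) :
  (forall n, 0 <= a n) ->
  (forall r, 0 < r -> exists C, forall n, a n <= C + r * n%:R) -> 0 < e ->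
  exists n, (j <= n)%N /\ a n <= a (n - j)%N + e.
Proof.
move=> a0 sub e0; apply: contrapT => H.
have {}H n : (j <= n)%N -> a (n - j)%N + e < a n.
  by move=> jn; rewrite ltNge; apply/negP => an; apply: H; exists n.
have lin k : k%:R * e <= a (k * j)%N.
  elim: k => [|k IH]; first by rewrite mul0r.
  have := H (k.+1 * j)%N; rewrite mulSn leq_addr addKn => /(_ isT)/ltW.
  by apply: le_trans; rewrite -natr1 mulrDl mul1r lerD2r.
have r0 : 0 < e / (2 * j.+1%:R) by rewrite divr_gt0// mulr_gt0.
have [C HC] := sub _ r0.
have [k Hk] : exists k : nat, 2 * C / e < k%:R.
  exists (Num.truncn (2 * C / e)).+1; exact: truncnS_gt.
have h2 := le_trans (lin k) (HC (k * j)%N).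
have h1 : e / (2 * j.+1%:R) * (k * j)%:R <= k%:R * (e / 2).
  have j0 : (j.+1%:R != 0 :> R) by rewrite pnatr_eq0.
  have hj : j%:R / j.+1%:R <= 1 :> R by rewrite ler_pdivrMr// mul1r ler_nat.
  rewrite natrM invfM (_ : _ * _ = (k%:R * (e / 2)) * (j%:R / j.+1%:R)); last by ring.
  by rewrite ler_piMr// mulr_ge0// divr_ge0// ltW.
move: Hk; rewrite ltr_pdivrMr// => Hk.
have := le_trans h2 (lerD (lexx C) h1); lra.
Qed.

Section mixtures.
Context {R : realType} {d : measure_display} {T : measurableType d}.
Variable Q : probability T R.
Local Open Scope ereal_scope.

(** Given [D = l], the pair [(U, V)] has the law of [(UL l, VL l)], so its conditional entropy is an
    average over [l], and a common lower bound survives averaging. *)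
Lemma condent_mixture (L I J : countType) (D : T -> L) (U : T -> I) (V : T -> J)
    (UL : L -> T -> I) (VL : L -> T -> J) (a : R) :
  discrete D -> discrete U -> discrete V ->
  (forall l, discrete (UL l)) -> (forall l, discrete (VL l)) ->
  (forall l v, law Q (fun t => (D t, V t)) (l, v) = law Q D l * law Q (VL l) v)%R ->
  (forall l u v, law Q (fun t => (U t, (D t, V t))) (u, (l, v)) =
     law Q D l * law Q (fun t => (UL l t, VL l t)) (u, v))%R ->
  (0 <= a)%R ->
  (forall l, a%:E <= condent Q (UL l) (VL l)) ->
  a%:E <= condent Q U (fun t => (D t, V t)).
Proof.
move=> dD dU dV dUL dVL lawV lawU a0 aUL.
have dDV := discrete_pair dD dV; have dW := discrete_pair dU dDV.
pose h l u v : R := ln (law Q (VL l) v / law Q (fun t => (UL l t, VL l t)) (u, v)).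
have h0 l u v : (0 <= h l u v)%R by exact: ln_law_ge0.
have -> : condent Q U (fun t => (D t, V t)) = \esum_(l in [set: L])
    ((law Q D l)%:E * condent Q (UL l) (VL l)).
  pose F w := (ln (law Q (fun t => (D t, V t)) w.2 /
    law Q (fun t => (U t, (D t, V t))) w))%:E.
  transitivity (\int[Q]_t F (U t, (D t, V t))); first by [].
  rewrite (integral_law Q dW (F := F)); last first.
    by case=> u p; rewrite lee_fin ln_law_ge0.
  rewrite (reindex_esum [set: L * (I * J)] _ (fun q => (q.2.1, (q.1, q.2.2)))); last first.
    split => //; first by move=> [l [u v]] [l' [u' v']] _ _ [-> -> ->].
    by move=> [u [l v]] _; exists (l, (u, v)).
  have c0 q : 0 <= (law Q D q.1)%:E * ((h q.1 q.2.1 q.2.2)%:E *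
      (law Q (fun t => (UL q.1 t, VL q.1 t)) q.2)%:E).
    by rewrite !mule_ge0// lee_fin ?law_ge0.
  transitivity (\esum_(q in [set: L * (I * J)]) ((law Q D q.1)%:E *
     ((h q.1 q.2.1 q.2.2)%:E * (law Q (fun t => (UL q.1 t, VL q.1 t)) q.2)%:E))).
    apply: eq_esum => -[l [u v]] _ /=; rewrite /F /= lawV lawU /h.
    have [->|l0] := eqVneq (law Q D l) 0%R; first by rewrite !mul0r mule0 mul0e.
    by rewrite -!EFinM; congr (_%:E); rewrite -mulf_div divff// mul1r mulrCA.
  rewrite (_ : [set: L * (I * J)] = [set: L] `*`` (fun=> [set: I * J])); last first.
    by apply/seteqP; split.
  rewrite -(esum_esum (a := fun l (p : I * J) => (law Q D l)%:E *
     ((h l p.1 p.2)%:E * (law Q (fun t => (UL l t, VL l t)) p)%:E))); last first.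
    by move=> l p _ _; exact: (c0 (l, p)).
  apply: eq_esum => l _; rewrite esumZl ?law_ge0//; last first.
    by move=> p; rewrite mule_ge0// lee_fin// law_ge0.
  congr (_ * _); have dULVL := discrete_pair (dUL l) (dVL l).
  apply/esym; apply: (integral_law Q dULVL (F := fun p => (h l p.1 p.2)%:E)).
  by move=> p; rewrite lee_fin.
rewrite -[leLHS]mule1 -(esum_law Q dD) -esumZl//; last first.
  by move=> l; rewrite lee_fin law_ge0.
by apply: le_esum => l _; rewrite muleC lee_wpmul2l ?lee_fin ?law_ge0.
Qed.

End mixtures.

Section walk_on_words.
Context {R : realType} {W : pointedCountType}.
Context {d : measure_display} {T : measurableType d} {Q : probability T R}.
Variables (mu : probability (word W) R) (X : nat -> {RV Q >-> word W}).
Hypothesis iidX : iid_with_law mu X.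
Local Open Scope ereal_scope.

Local Notation inc := (increments X 0).

Definition position n (t : T) : nat := size (word_walk [::] (inc t) n).

Definition boundary_prefix K (t : T) : option (word W) :=
  limit_prefix [::] K (inc t).

Lemma discrete_increments (I : countType) (f : path_space W -> I) :
  discrete f -> discrete (f \o inc).
Proof. by move=> df; apply: (measurable_discrete df); exact: measurable_increments. Qed.

Lemma discrete_position n : discrete (position n).
Proof.
apply: (discrete_increments (f := fun y => size (word_walk [::] y n))).
exact: (discrete_comp size (discrete_word_walk _ _)).
Qed.

Lemma discrete_boundary_prefix K : discrete (boundary_prefix K).
Proof. exact: (discrete_increments (@discrete_limit_prefix _ _ _)). Qed.

(** All increments from time [N] on are empty with probability at most [p ^ n] for every [n], where
    [p < 1] is the mass of the empty word. *)
Lemma escaping_almost_surely : mu [set [::]] < 1 ->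
  Q (inc @^-1` [set y : path_space W | escaping y]) = 1.
Proof.
move=> mu1; set p := fine (mu [set [::]]).
have pE : mu [set [::]] = p%:E by rewrite fineK// fin_num_measure.
have p0 : (0 <= p)%R by exact: fine_ge0.
have p1 : (p < 1)%R by rewrite -lte_fin -pE.
pose S N := [set t | forall i, (N <= i)%N -> X i t = [::]].
have mS N : measurable (S N).
  rewrite (_ : S N = \bigcap_i (X i @^-1` [set w | (N <= i)%N -> w = [::]])).
    by apply: bigcapT_measurable => i; exact: (discrete_preimage _ (discrete_RV _ _)).
  by apply/seteqP; split => t h i //; [move=> _; exact: h|exact: (h i Logic.I)].
have S0 N : Q (S N) = 0.
  have le n : Q (S N) <= (p ^+ n)%:E.
    pose A i : set (word W) := if (i < N)%N then setT else [set [::]].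
    apply: (@le_trans _ _ (Q [set t | forall i, (i < N + n)%N -> A i (X i t)])).
      apply: le_probability => //.
        rewrite (_ : mkset _ = \bigcap_i (X i @^-1` [set w | (i < N + n)%N -> A i w])).
          by apply: bigcapT_measurable => i; exact: (discrete_preimage _ (discrete_RV _ _)).
        by apply/seteqP; split => t h i //; [move=> _; exact: h|exact: (h i Logic.I)].
      by move=> t h i _; rewrite /A; case: ltnP => // Ni; exact: h.
    rewrite (probability_bigcap_RV iidX) big_split_ord/= big1 ?mul1e.
      rewrite (eq_bigr (fun=> p%:E)); last first.
        by move=> i _; rewrite /A ifN ?pE// -leqNgt leq_addr.
      by rewrite prodEFin big_const_ord iter_mulr_1.
    by move=> i _; rewrite /A ltn_ord probability_setT.
  apply/eqP; rewrite eq_le measure_ge0 andbT.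
  have fS : Q (S N) \is a fin_num by exact: fin_num_measure.
  rewrite -(fineK fS) lee_fin; apply/ler_addgt0Pr => e e0; rewrite add0r.
  have /cvgrPdist_le/(_ _ e0)[n _ hn] : (p ^+ n)%R @[n --> \oo] --> (0%R : R).
    by apply: cvg_expr; rewrite ger0_norm.
  have := hn n (leqnn n); rewrite /= sub0r normrN ger0_norm ?exprn_ge0// => pe.
  by apply: le_trans pe; rewrite -lee_fin fineK.
have -> : inc @^-1` [set y : path_space W | escaping y] = ~` \bigcup_N S N.
  apply/seteqP; split => t /=.
    by move=> esc [N _ SN]; have [i [Ni /eqP]] := esc N; apply; exact: SN.
  move=> h N; apply: contrapT => H; apply: h; exists N => // i Ni.
  by apply: contrapT => /eqP ?; apply: H; exists i.
rewrite probability_setC; last exact: bigcupT_measurable.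
suff -> : Q (\bigcup_N S N) = 0 by rewrite sube0.
apply/eqP; rewrite eq_le measure_ge0 andbT.
apply: (le_trans (measure_sigma_subadditive Q mS (bigcupT_measurable _ mS) (@subset_refl _ _))).
by rewrite eseries0// => i _ _; exact: S0.
Qed.

Lemma position_sum n t : position n t = (\sum_(i < n) size (X i t))%N.
Proof.
rewrite /position /word_walk /= size_flatten /shape -map_comp sumnE big_map.
have -> : iota 0 n = index_iota 0 n by rewrite /index_iota subn0.
by rewrite big_mkord.
Qed.

Lemma entropy_position_sublinear (e : R) :
  entropy Q (size \o X 0%N) < +oo -> (0 < e)%R ->
  exists C : R, forall n, entropy Q (position n) <= (C + e * n%:R)%:E.
Proof.
move=> fin e0.
have [||//|//|C HC] := @entropy_sum_sublinear _ _ _ Q (fun i => size \o X i) e.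
- by move=> i; exact: (discrete_comp size (discrete_RV _ _)).
- move=> i k; rewrite /law; congr fine.
  rewrite (law_RV iidX i (size @^-1` [set k])).
  by rewrite (law_RV iidX 0%N (size @^-1` [set k])).
exists C => n; rewrite (_ : position n = (fun t => \sum_(i < n) size (X i t))%N)//.
by apply/funext => t; rewrite position_sum.
Qed.

Lemma law_first_increments (I : countType) (f : path_space W -> I) j us i :
  discrete f ->
  law Q (fun t => (first_increments X j t, f (increments X j t))) (us, i) =
  (law Q (first_increments X j) us * law Q (f \o inc) i)%R.
Proof.
move=> df; apply: EFin_inj; rewrite EFinM.
rewrite !lawE; [|exact: discrete_increments|exact: discrete_first_increments|]; last first.
  apply: discrete_pair; first exact: discrete_first_increments.
  by apply: (measurable_discrete df); exact: measurable_increments.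
rewrite -(increments_independent iidX j us (E := f @^-1` [set i])); last exact: df.
by congr (Q _); apply/seteqP; split => t /= [-> ->].
Qed.

(* Once the first increments, with product [g], are known, both the position and
   the limit word are those of an independent copy of the walk with [g] put in
   front. *)
Lemma condent_position_first_increments j n K (a : R) : (j <= n)%N -> (0 <= a)%R ->
  (forall K', a%:E <= condent Q (position (n - j)%N) (boundary_prefix K')) ->
  a%:E <= condent Q (position n)
    (fun t => (first_increments X j t, boundary_prefix K t)).
Proof.
move=> jn a0 H.
pose UL (us : seq (word W)) t := size (word_walk (flatten us) (inc t) (n - j)%N).
pose VL (us : seq (word W)) t := limit_prefix (flatten us) K (inc t).
have dU us : discrete (fun y : path_space W => size (word_walk (flatten us) y (n - j)%N)).
  exact: (discrete_comp size (discrete_word_walk _ _)).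
have dUL us : discrete (UL us) by exact: (discrete_increments (dU us)).
have dVL us : discrete (VL us) by exact: (discrete_increments (@discrete_limit_prefix _ _ _)).
have flat t us : first_increments X j t = us ->
    [seq inc t i | i <- iota 0 j] = us by [].
have posE t us : first_increments X j t = us ->
    position n t = size (word_walk (flatten us) (increments X j t) (n - j)%N).
  by move=> /flat <-; rewrite /position -[in LHS](subnKC jn) word_walkD.
have bpE t us : first_increments X j t = us ->
    boundary_prefix K t = limit_prefix (flatten us) K (increments X j t).
  by move=> /flat <-; rewrite /boundary_prefix (limit_prefix_shift _ _ _ j).
apply: (@condent_mixture _ _ _ Q _ _ _ (first_increments X j) (position n)
  (boundary_prefix K) UL VL) => //.
- exact: discrete_first_increments.
- exact: discrete_position.
- exact: discrete_boundary_prefix.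
- move=> us v; rewrite -(law_first_increments j us v (discrete_limit_prefix (flatten us) K)).
  rewrite /law; congr (fine (Q _)); apply/seteqP; split => t /= [e <-];
    by rewrite e -(bpE _ _ e).
- move=> us u v.
  have dp := discrete_pair (dU us) (@discrete_limit_prefix _ (flatten us) K).
  rewrite -(law_first_increments j us (u, v) dp) /law; congr (fine (Q _)).
  apply/seteqP; split => t /=; first by move=> [<- e <-]; rewrite e -(bpE _ _ e) -(posE _ _ e).
  by move=> [e <- <-]; rewrite e -(bpE _ _ e) -(posE _ _ e).
(* The part of the prefix beyond the first increments has length [K - size (flatten us)], which
   varies with [us]; hence [H] is asked for every prefix length. *)
move=> us; apply: (le_trans (H (K - size (flatten us))%N)).
rewrite le_eqVlt; apply/orP; left; apply/eqP; apply: eq_condent => s t.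
  exact: iff_sym (limit_prefix_fiber _ _ _ _).
move=> _; rewrite /UL /position /word_walk !size_cat !add0n.
by split => [->//|/addnI].
Qed.

End walk_on_words.

Lemma condent_le_entropy {R : realType} {d : measure_display}
    {T : measurableType d} (Q : probability T R) (I J : countType)
    (U : T -> I) (V : T -> J) : discrete U -> discrete V ->
  (condent Q U V <= entropy Q U)%E.
Proof.
move=> dU dV; rewrite (eq_condent Q (U' := U) (V' := fun t => (V t, tt))) => //.
  by apply: condent_le => //; exact: discrete_cst.
by move=> s t; split => [->|[]].
Qed.

(** * Invariant events and prefixes of the limit word *)

Section boundary_approximation.
Context {R : realType} {W : pointedCountType}.
Context {d : measure_display} {T : measurableType d} {Q : probability T R}.
Variables (mu : probability (word W) R) (X : nat -> {RV Q >-> word W}).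
Hypothesis iidX : iid_with_law mu X.
Hypothesis mu1 : (mu [set [::]] < 1)%E.
Hypothesis entropy_fin : (entropy Q (size \o X 0%N) < +oo)%E.
Variable B : set (path_space W).
Hypothesis mB : measurable B.
Hypothesis shiftB : forall x j, B x <-> B (fun n => x (j + n)%N).
Local Open Scope ereal_scope.

Local Notation inc := (increments X 0).
Local Notation pos := (position X).
Local Notation bp := (boundary_prefix X).

Let Bt := inc @^-1` (word_walk [::] @^-1` B).

Let measurable_start g : measurable (word_walk g @^-1` B).
Proof. by rewrite -[X in measurable X]setTI; exact: measurable_word_walk. Qed.

Let mBt : measurable Bt.
Proof. exact: measurable_increments_preimage. Qed.

(** The harmonic function attached to the invariant set [B]. *)
Let hitting_probability (g : word W) : R :=
  fine (Q (inc @^-1` (word_walk g @^-1` B))).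

(** By shift invariance a path lies in [B] exactly when its continuation from time [n] does, and by
    independence that continuation is a fresh walk started at the product of the first
    increments. *)
Let hitting_probabilityE n us : (0 < law Q (first_increments X n) us)%R ->
  hitting_probability (flatten us) = condprob Q Bt (first_increments X n) us.
Proof.
move=> l0; rewrite /condprob.
have -> : Bt `&` first_increments X n @^-1` [set us] =
    first_increments X n @^-1` [set us] `&`
    increments X n @^-1` (word_walk (flatten us) @^-1` B).
  have E t : first_increments X n t = us ->
      (fun k => word_walk [::] (inc t) (n + k)%N) =
      word_walk (flatten us) (increments X n t).
    by move=> <-; apply/funext => k; rewrite word_walkD.
  have BE t : first_increments X n t = us ->
      Bt t <-> B (word_walk (flatten us) (increments X n t)).
    by move=> e; rewrite -(E t e); exact: shiftB.
  by apply/seteqP; split => t [h1 h2]; split => //; apply/BE.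
rewrite (increments_independent iidX)// fineM; last 2 first.
- by apply: fin_num_measure; exact: discrete_first_increments.
- by apply: fin_num_measure; exact: measurable_increments_preimage.
by rewrite mulrC mulKf// gt_eqF.
Qed.

(* Levy's 0-1 law for [B], in the form needed here: the harmonic function at time
   [n] does at least as well as any event of the first [j <= n] increments. *)
Let walk_approximation j (D : set (seq (word W))) n : (j <= n)%N ->
  Q (Bt `+` [set t | (2^-1 < hitting_probability (word_walk [::] (inc t) n))%R])
    <= Q (Bt `+` first_increments X j @^-1` D).
Proof.
move=> jn.
have -> : first_increments X j @^-1` D =
    first_increments X n @^-1` [set us | D (take j us)].
  by apply/seteqP; split => t /=; rewrite (first_incrementsE X t jn).
exact: (@condprob_half_closest _ _ _ Q _ _ (discrete_first_increments X n)
  Bt (fun us => hitting_probability (flatten us)) [set us | D (take j us)] mBt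
  (@hitting_probabilityE n)).
Qed.

(* The conditional entropy of the position at time [n] given the whole limit
   word. *)
Let rate n : R := fine (ereal_inf (range (fun K => condent Q (pos n) (bp K)))).

Let entropy_position_lty n : entropy Q (pos n) < +oo.
Proof.
have [C HC] := entropy_position_sublinear iidX entropy_fin ltr01.
exact: le_lt_trans (HC n) (ltry _).
Qed.

Let condent_lty n K : condent Q (pos n) (bp K) < +oo.
Proof.
apply: le_lt_trans (entropy_position_lty n).
by apply: condent_le_entropy; [exact: discrete_position|exact: discrete_boundary_prefix].
Qed.

Let rateE n : (rate n)%:E = ereal_inf (range (fun K => condent Q (pos n) (bp K))).
Proof.
rewrite fineK// ge0_fin_numE.
  by apply: le_lt_trans (condent_lty n 0); apply: ereal_inf_lbound; exists 0%N.
apply: le_ereal_inf_tmp => _ [K _ <-].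
by apply: condent_ge0; [exact: discrete_position|exact: discrete_boundary_prefix].
Qed.

Let rate_le n K : (rate n)%:E <= condent Q (pos n) (bp K).
Proof. by rewrite rateE; apply: ereal_inf_lbound; exists K. Qed.

Let rate_ge0 n : (0 <= rate n)%R.
Proof.
rewrite -lee_fin rateE; apply: le_ereal_inf_tmp => _ [K _ <-].
by apply: condent_ge0; [exact: discrete_position|exact: discrete_boundary_prefix].
Qed.

Let rate_sublinear r : (0 < r)%R -> exists C, forall n, (rate n <= C + r * n%:R)%R.
Proof.
move=> r0; have [C HC] := entropy_position_sublinear iidX entropy_fin r0.
exists C => n; rewrite -lee_fin; apply: le_trans (HC n).
apply: (le_trans (rate_le n 0)).
by apply: condent_le_entropy; [exact: discrete_position|exact: discrete_boundary_prefix].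
Qed.

Let rate_approximated n e : (0 < e)%R ->
  exists K0, forall K, (K0 <= K)%N -> condent Q (pos n) (bp K) <= (rate n + e)%:E.
Proof.
move=> e0.
have [|_ [K0 _ <-] HK0] := @lb_ereal_inf_adherent _
    (range (fun K => condent Q (pos n) (bp K))) e e0.
  by rewrite -rateE.
exists K0 => K KK; rewrite EFinD rateE; apply: le_trans (ltW HK0).
have dp := discrete_position X n; have db := discrete_boundary_prefix X.
rewrite (eq_condent Q (U' := pos n) (V' := fun t => (bp K t, bp K0 t))) => //.
  exact: condent_le.
move=> s t; split => [e1|[]//]; congr (_, _) => //.
exact: (limit_prefix_coarse KK e1).
Qed.

Let position_tight n e : (0 < e)%R ->
  exists L, Q (pos n @^-1` [set k | (L < k)%N]) <= e%:E.
Proof.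
move=> e0; have dp := discrete_position X n.
have [||L HL] := @esum_tail R (fun k => (law Q (pos n) k)%:E) e _ _ e0.
- by move=> k; rewrite lee_fin law_ge0.
- by rewrite esum_law// ltry.
by exists L; rewrite (probability_preimage Q dp).
Qed.

Lemma boundary_prefix_approximation (e : R) : (0 < e)%R ->
  exists K (C : set (option (word W))),
    Q (Bt `+` bp K @^-1` C) <= (12 * e)%:E.
Proof.
(* Half of [e^2] is spent on the growth of [rate], half on replacing the limit word by a prefix.
   With [s = e] the error [s + s^-1 * e^2] is [2 e], and the total is
   [2 e + 2 (2 e + 3 e) = 12 e]. *)
move=> e0; have ee0 : (0 < e ^+ 2 / 2)%R by rewrite divr_gt0// exprn_gt0.
have [j [D HD]] := cylinder_approximation X (measurable_start [::]) e0.
have [n [jn Hn]] := sublinear_increment j rate_ge0 rate_sublinear ee0.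
have [K0 HK0] := rate_approximated n ee0.
have [K1 HK1] := position_tight n e0.
(* [K0] makes the conditional entropy nearly minimal; [K1] makes the prefix contain the position at
   time [n] up to probability [e], so that [A] can decode the word from its length. *)
pose K := (K0 + K1)%N.
have dp := discrete_position X n; have db := discrete_boundary_prefix X K.
have dF := discrete_first_increments X j.
pose A : set (nat * option (word W)) := [set p | exists z,
  [/\ p.2 = Some z, (p.1 <= K)%N & (2^-1 < hitting_probability (take p.1 z))%R]].
have le_info : condent Q (pos n) (bp K) <=
    condent Q (pos n) (fun t => (first_increments X j t, bp K t)) + (e ^+ 2)%:E.
  apply: (@le_trans _ _ ((rate (n - j)%N)%:E + (e ^+ 2)%:E)).
    apply: (le_trans (HK0 K (leq_addr _ _))).
    rewrite -EFinD lee_fin; move: Hn; lra.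
  by rewrite leeD2r//; apply: (condent_position_first_increments iidX).
have [C HC] := approximation_by_conditioning dp dF db A D e0 (condent_lty n K) le_info.
exists K, C.
set EA := (fun t => (pos n t, bp K t)) @^-1` A in HC.
set G := [set t | (2^-1 < hitting_probability (word_walk [::] (inc t) n))%R].
have mEA : measurable EA by apply: discrete_preimage; exact: discrete_pair.
have mG : measurable G.
  have dw := discrete_increments X (@discrete_word_walk W [::] n).
  exact: (discrete_preimage [set g | (2^-1 < hitting_probability g)%R] dw).
have mD : measurable (first_increments X j @^-1` D) by exact: discrete_preimage.
have mC : measurable (bp K @^-1` C) by exact: discrete_preimage.
have BG : Q (Bt `+` G) <= e%:E.
  by apply: (le_trans (walk_approximation D jn)).
have GA : Q (G `+` EA) <= e%:E.
  have mesc : measurable (inc @^-1` [set y : path_space W | escaping y]).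
    by apply: measurable_increments_preimage; exact: (@measurable_escaping W).
  have mtail : measurable (pos n @^-1` [set k | (K1 < k)%N]) by exact: discrete_preimage.
  apply: (@le_trans _ _ (Q (~` (inc @^-1` [set y : path_space W | escaping y]) `|`
      pos n @^-1` [set k | (K1 < k)%N]))).
    apply: le_probability; [exact: measurableY|by apply: measurableU => //; exact: measurableC|].
    move=> t; apply: contraPP => /not_orP[/contrapT /= esc /negP].
    rewrite -leqNgt => posK.
    have posK' : (pos n t <= K)%N by rewrite (leq_trans posK)// leq_addl.
    have bpE : bp K t = Some (mkseq (limit_map (word_walk [::] (inc t))) K).
      by rewrite /boundary_prefix /limit_prefix asboolT.
    have wE : take (pos n t) (mkseq (limit_map (word_walk [::] (inc t))) K) =
        word_walk [::] (inc t) n.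
      by rewrite -map_take take_iota (minn_idPl posK') [RHS](@word_walkE W [::] (inc t) n esc).
    have EAE : EA t <-> G t.
      rewrite /EA /A /G /= bpE; split; first by move=> [z [[<-] _]]; rewrite wE.
      move=> h; exists (mkseq (limit_map (word_walk [::] (inc t))) K).
      by split => //; rewrite wE.
    by move=> [[Gt nEA]|[EAt nG]]; [apply/nEA/EAE|apply/nG/EAE].
  apply: (le_trans (measureU2 _ _ mtail)); first exact: measurableC.
  have nesc : Q (~` (inc @^-1` [set y : path_space W | escaping y])) = 0.
    by rewrite probability_setC// (escaping_almost_surely iidX)// subee.
  rewrite -[leRHS]add0e; apply: leeD => //.
  by rewrite le_eqVlt; apply/orP; left; apply/eqP; exact: nesc.
have BA : Q (Bt `+` EA) <= (e + e)%:E.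
  apply: (le_trans (probabilityY_triangle Q mBt mG mEA)).
  by rewrite EFinD leeD.
have AD : Q (EA `+` first_increments X j @^-1` D) <= (e + e + e)%:E.
  apply: (le_trans (probabilityY_triangle Q mEA mBt mD)).
  by rewrite EFinD leeD// setYC.
apply: (le_trans (probabilityY_triangle Q mBt mEA mC)).
apply: (@le_trans _ _ ((e + e)%:E + 2%:E * ((e + e^-1 * e ^+ 2)%:E + (e + e + e)%:E))).
  apply: leeD => //; apply: (le_trans HC).
  by rewrite lee_wpmul2l// leeD2l.
rewrite -!EFinD lee_fin expr2 mulKf ?gt_eqF//; lra.
Qed.

End boundary_approximation.

(** * Invariant sets *)

Section finite_entropy.
Context {R : realType} {W : pointedCountType}.
Context {d : measure_display} {T : measurableType d} {Q : probability T R}.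
Variables (mu : probability (word W) R) (X : nat -> {RV Q >-> word W}).
Hypothesis iidX : iid_with_law mu X.
Local Open Scope ereal_scope.

Let law_step g : law Q (X 0%N) g = fine (mu [set g]).
Proof. by rewrite /law (law_RV iidX 0%N [set g]). Qed.

(** The one-letter word [[:: point]] is not a product of empty words, so some nonempty word is
    charged. *)
Lemma generating_lt1 : generating mu -> mu [set [::]] < 1.
Proof.
move=> gen; have [s [pos se]] := gen [:: point].
have [h hs h0] : exists2 h, h \in s & h != [::].
  apply: contrapT => H; suff : flatten s = [::] by rewrite -se.
  elim: s {se pos} H => // a s IH H /=; rewrite IH.
    have [->//|a0] := eqVneq a [::].
    by exfalso; apply: H; exists a => //; rewrite mem_head.
  by move=> [h hs h0]; apply: H; exists h => //; rewrite inE hs orbT.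
have muh := pos _ hs.
have : mu ([set [::]] `|` [set h]) <= 1 by exact: probability_le1.
rewrite measureU//; last first.
  by apply/seteqP; split => // w [/= -> /esym/eqP]; rewrite (negbTE h0).
apply: lt_le_trans; rewrite -[ltLHS]adde0 lteD2lE//.
by rewrite fin_num_measure.
Qed.

Lemma entropy_size_lty : finite_entropy mu \/ finite_log_moment mu ->
  entropy Q (size \o X 0%N) < +oo.
Proof.
have dX := discrete_RV X 0.
case=> [fin|fin].
  apply: le_lt_trans fin; apply: (le_trans (entropy_comp_le Q size dX)).
  rewrite entropyE//; apply: le_esum => g _; rewrite law_step -EFinM lee_fin.
  set p := fine _; have p0 : (0 <= p)%R by exact: fine_ge0.
  have [->|pn0] := eqVneq p 0%R; first by rewrite mulr0 mul0r oppr0.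
  by rewrite lnV ?posrE ?lt0r ?pn0// mulNr mulrC.
have dS : discrete (size \o X 0%N) by exact: discrete_comp.
apply: (le_lt_trans (entropy_le_log Q dS)).
pose l (g : word W) : \bar R := (ln (size g)%:R)%:E.
have l0 g : 0 <= l g.
  rewrite lee_fin; case: (size g) => [|k]; first by rewrite ln0.
  by rewrite ln_ge0// ler1n.
have fl : \int[Q]_t l (X 0%N t) < +oo.
  rewrite (integral_law Q dX (F := l))//; apply: le_lt_trans fin.
  by apply: le_esum => g _; rewrite law_step /l -EFinM mulrC.
(* For a length [s > 0], [(s + 1) (s + 2) <= (2 s) (3 s) = 6 s^2]; for [s = 0] the left side is 2
   and [ln 0 = 0]. *)
apply: (@le_lt_trans _ _ (\int[Q]_t (l (X 0%N t) + (l (X 0%N t) + (ln 6)%:E)))).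
  have ln6 : 0 <= (ln 6 : R)%:E by rewrite lee_fin ln_ge0// ler1n.
  apply: (le_integral_law dX
    (F := fun g : word W => (ln ((size g).+1%:R * (size g).+2%:R))%:E)
    (G := fun g : word W => l g + (l g + (ln 6)%:E))) => [g|g|g _].
  - by rewrite lee_fin ln_ge0// -natrM ler1n muln_gt0.
  - by rewrite !adde_ge0.
  rewrite /l -!EFinD lee_fin; case: (size g) => [|k].
    have -> : ln (0%:R : R) = 0%R by rewrite ln0.
    rewrite !add0r ler_ln ?posrE ?mulr_gt0//.
    by rewrite -natrM ler_nat.
  rewrite -!lnM ?posrE ?mulr_gt0// ler_ln ?posrE ?mulr_gt0//.
  rewrite -!natrM ler_nat (_ : (k.+1 * (k.+1 * 6) = (k.+1 * 2) * (k.+1 * 3))%N).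
    apply: leq_mul; first by rewrite muln2 -addnn -(addn1 k.+1) leq_add2l.
    by rewrite mulnSr addnC -(addn2 k.+1) leq_add2l leq_pmull.
  by rewrite mulnACA mulnA.
have -> : \int[Q]_t (l (X 0%N t) + (l (X 0%N t) + (ln 6)%:E)) =
    \int[Q]_t l (X 0%N t) + (\int[Q]_t l (X 0%N t) + (ln 6)%:E).
  have ln6 : 0 <= (ln 6 : R)%:E by rewrite lee_fin ln_ge0// ler1n.
  rewrite (integral_lawD Q dX (F := l) (G := fun g => l g + (ln 6)%:E))//; last first.
    by move=> g; rewrite adde_ge0.
  rewrite (integral_lawD Q dX (F := l) (G := cst (ln 6)%:E))//.
  by rewrite integral_prob_cst.
by apply: lte_add_pinfty => //; apply: lte_add_pinfty => //; rewrite ltry.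
Qed.

End finite_entropy.

(** Borel-Cantelli: when the errors are bounded by the summable [telescoping_weight], almost every
    point disagrees with only finitely many approximating events, so [B] agrees almost surely with
    their upper limit. *)
Lemma preimage_approximation {R : realType} d (T : measurableType d)
    (Q : probability T R) d' (S : measurableType d') (f : T -> S) (B : set T) :
  measurable_fun setT f -> measurable B ->
  (forall e : R, 0 < e -> exists C : set S, measurable C /\
    (Q (B `+` f @^-1` C) <= e%:E)%E) ->
  exists C : set S, measurable C /\ Q (B `+` f @^-1` C) = 0%E.
Proof.
move=> mf mB H.
have w0 i : 0 < telescoping_weight i :> R by rewrite invr_gt0 mulr_gt0.
pose C i := projT1 (cid (H _ (w0 i))).
have [mC CP] : (forall i, measurable (C i)) /\
    forall i, (Q (B `+` f @^-1` C i) <= (telescoping_weight i)%:E)%E.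
  by split => i; have [] := projT2 (cid (H _ (w0 i))).
pose L := lim_sup_set C; exists L.
have mL : measurable L.
  by apply: bigcapT_measurable => n; apply: bigcup_measurable.
split => //.
have mfS (A : set S) : measurable A -> measurable (f @^-1` A).
  by move=> mA; rewrite -[X in measurable X]setTI; exact: mf.
pose F i := B `+` f @^-1` C i.
have mF i : measurable (F i) by apply: measurableY => //; exact: mfS.
have F0 : (Q (lim_sup_set F) = 0)%E.
  apply: lim_sup_set_cvg0 => //; apply: (@le_lt_trans _ _ 1%E); last by rewrite ltry.
  rewrite nneseries_esumT//; apply: le_trans (@esum_telescoping_weight R).
  by apply: le_esum => i _; exact: CP.
apply/eqP; rewrite eq_le measure_ge0 andbT -F0 le_probability//.
- by apply: measurableY => //; exact: mfS.
- by apply: bigcapT_measurable => n; apply: bigcup_measurable => k _; exact: mF.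
move=> t [[Bt nL]|[Lt nB]] n _; last first.
  by have [k nk Ck] := Lt n Logic.I; exists k => //; right.
have [m mP] : exists m, forall k, (m <= k)%N -> ~ C k (f t).
  apply: contrapT => N; apply: nL => m _; apply: contrapT => M; apply: N.
  by exists m => k mk Ck; apply: M; exists k.
exists (m + n)%N; first by rewrite /= leq_addl.
by left; split => //; apply: mP; exact: leq_addr.
Qed.

Section invariant_sets.
Context {R : realType} {W : pointedCountType}.
Context {d : measure_display} {T : measurableType d} {Q : probability T R}.
Variables (mu : probability (word W) R) (X : nat -> {RV Q >-> word W}).
Hypothesis iidX : iid_with_law mu X.
Hypothesis mu1 : (mu [set [::]] < 1)%E.
Hypothesis entropy_fin : (entropy Q (size \o X 0%N) < +oo)%E.
Local Open Scope ereal_scope.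

Lemma measurable_walk g : measurable_fun setT (walk X g).
Proof. exact: (measurableT_comp (measurable_word_walk g) (measurable_increments X 0)). Qed.

Lemma measurable_walk_preimage g (E : set (path_space W)) :
  measurable E -> measurable (walk X g @^-1` E).
Proof. by move=> mE; rewrite -[X in measurable X]setTI; exact: measurable_walk. Qed.

Lemma invariant_set_limit (B : set (path_space W)) :
  measurable B -> union_of_classes B ->
  exists C : set (infinite_words W),
    measurable C /\ walk_law X [::] (B `+` limit_map @^-1` C) = 0.
Proof.
move=> mB uB.
have shiftB x j : B x <-> B (fun n => x (j + n)%N).
  split; apply: uB; [exists j, 0%N|exists 0%N, j] => n;
    by rewrite addn0 addnC.
have mlim : measurable_fun setT (limit_map \o walk X [::]).
  exact: (measurableT_comp measurable_limit_map (measurable_walk [::])).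
apply: (preimage_approximation mlim (measurable_walk_preimage [::] mB)) => e e0.
have e12 : (0 < e / 12)%R by rewrite divr_gt0.
have [K [C HC]] := boundary_prefix_approximation iidX mu1 entropy_fin mB shiftB e12.
(* Dropping the value [None] changes the event only on non-escaping sequences, which have
   probability zero. *)
exists [set xi | C (Some (mkseq xi K))].
have mC : measurable [set xi : infinite_words W | C (Some (mkseq xi K))].
  exact: (discrete_preimage (fun z => C (Some z)) (@discrete_mkseq W K)).
split => //.
have mBt : measurable (walk X [::] @^-1` B) by exact: measurable_walk_preimage.
have mL : measurable ((limit_map \o walk X [::]) @^-1` [set xi | C (Some (mkseq xi K))]).
  by rewrite -[X in measurable X]setTI; exact: mlim.
have mbp : measurable (boundary_prefix X K @^-1` C).
  exact: (discrete_preimage C (discrete_boundary_prefix X K)).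
apply: (le_trans (probabilityY_triangle Q mBt mbp mL)).
have -> : e%:E = (12 * (e / 12))%:E + 0.
  by rewrite adde0; congr (_%:E); lra.
apply: leeD; first exact: HC.
have mesc : measurable (increments X 0 @^-1` [set y : path_space W | escaping y]).
  by apply: measurable_increments_preimage; exact: (@measurable_escaping W).
have <- : Q (~` (increments X 0 @^-1` [set y : path_space W | escaping y])) = 0.
  by rewrite probability_setC// (escaping_almost_surely iidX)// subee.
apply: le_probability; [exact: measurableY|exact: measurableC|].
move=> t; apply: contraPP => /contrapT /= esc.
have bpE : boundary_prefix X K t = Some (mkseq (limit_map (walk X [::] t)) K).
  by rewrite /boundary_prefix /limit_prefix asboolT.
by rewrite /setY /= bpE; tauto.
Qed.

End invariant_sets.

(** * Standard Borel models *)

Section measurable_selections.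
Context {R : realType} {d : measure_display} {G : measurableType d}.

(** [C k w] stands for the event, in the model, that letter [k] is [w]. Outside a null set these
    events are consistent and determine [L]; elsewhere [L] only has to be some measurable choice. *)
Lemma measurable_sequence_selection (W : pointedCountType)
    (C : nat -> W -> set G) : (forall k w, measurable (C k w)) ->
  exists L : G -> infinite_words W, measurable_fun setT L /\
    forall c y, (forall k w, C k w c <-> y k = w) -> L c = y.
Proof.
move=> mC.
(* Among the letters [w] with [C k w c], take the one of least code. *)
pose D k w := C k w `&` \bigcap_n [set c | forall v : W,
  choice.unpickle n = Some v -> C k v c -> (choice.pickle w <= choice.pickle v)%N].
have mD k w : measurable (D k w).
  apply: measurableI => //; apply: bigcapT_measurable => n.
  case: (choice.unpickle n) => [v|]; last first.
    by rewrite (_ : mkset _ = setT)//; apply/seteqP; split.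
  have [wv|wv] := boolP (choice.pickle w <= choice.pickle v)%N.
    by rewrite (_ : mkset _ = setT)//; apply/seteqP; split => // c _ _ [<-].
  rewrite (_ : mkset _ = ~` C k v); first exact: measurableC.
  apply/seteqP; split => c /=; first by move=> h Cv; move: (h v erefl Cv); rewrite (negbTE wv).
  by move=> nC _ [<-] /nC.
have Duniq k w w' c : D k w c -> D k w' c -> w = w'.
  move=> [Cw hw] [Cw' hw']; apply: (pcan_inj (@choice.pickleK W)).
  apply/eqP; rewrite eqn_leq.
  rewrite (hw (choice.pickle w') Logic.I w' (choice.pickleK _) Cw').
  by rewrite (hw' (choice.pickle w) Logic.I w (choice.pickleK _) Cw).
pose L c : infinite_words W := fun k => get [set w | D k w c].
have LD k w c : D k w c -> L c k = w.
  by move=> Dw; apply: (@Duniq k _ _ c) => //; apply: (@getPex _ [set w | D k w c]); exists w.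
exists L; split; last first.
  move=> c y Cy; apply/funext => k; apply: LD; split; first exact/Cy.
  by move=> n _ v _ /Cy ->.
apply: (@measurable_sequence_map W _ G) => k B.
rewrite (_ : mkset _ = \bigcup_w (if `[< B w >] then D k w else set0) `|`
    (if `[< B point >] then ~` \bigcup_w D k w else set0)).
  have cW : countable [set: W] by exact: (@countableP (Countable.clone W _) setT).
  apply: measurableU.
    by apply: (countable_bigcupT_measurable cW) => w; case: ifP.
  case: ifP => // _; apply: measurableC.
  exact: (countable_bigcupT_measurable cW).
have Lpoint c : ~ (\bigcup_w D k w) c -> L c k = point.
  by move=> nD; apply: xgetPN => w Dw; apply: nD; exists w.
apply/seteqP; split => c /=.
  have [[w _ Dw]|nD] := pselect ((\bigcup_w D k w) c).
    by rewrite (LD _ _ _ Dw) => Bw; left; exists w => //; rewrite asboolT.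
  by rewrite Lpoint// => Bp; right; rewrite asboolT.
move=> [[w _]|]; case: asboolP => // Bw; first by move/LD ->.
by move/Lpoint ->.
Qed.

(** A real number is the infimum of the rationals above it, and the infimum of the [q] with [C q c]
    is measurable in [c] even where the sets [C q] do not increase with [q]. *)
Lemma measurable_real_selection (C : rat -> set G) :
  (forall q, measurable (C q)) ->
  exists r : G -> R, measurable_fun setT r /\
    forall c a, (forall q, C q c <-> a < ratr q) -> r c = a.
Proof.
move=> mC.
pose F c : \bar R := ereal_inf [set (ratr q)%:E | q in [set q | C q c]].
have mF : measurable_fun setT F.
  apply: (measurability _ (ErealGenInftyO.measurableE R)) => //.
  move=> _ [_ [a ->] <-]; rewrite setTI.
  rewrite (_ : _ @^-1` _ = \bigcup_q (if ratr q < a then C q else set0)).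
    by apply: bigcupT_measurable_rat => q; case: ifP.
  apply/seteqP; split => c; rewrite /= in_itv /=.
    move=> /ereal_inf_lt[_ [q Cq <-]]; rewrite lte_fin => qa.
    by exists q => //; rewrite qa.
  move=> [q _]; case: ifP => // qa Cq.
  apply: (@le_lt_trans _ _ (ratr q)%:E); last by rewrite lte_fin.
  by apply: ereal_inf_lbound; exists q.
exists (fine \o F); split; first exact: (measurableT_comp (fine_measurable measurableT) mF).
move=> c a Ca; suff Fc : F c = a%:E by rewrite /= Fc.
apply/eqP; rewrite eq_le; apply/andP; split; last first.
  by apply: le_ereal_inf_tmp => _ [q /Ca aq <-]; rewrite lee_fin ltW.
apply/lee_addgt0Pr => e e0.
have [q] : exists q, ratr q \in `]a, a + e[ by apply: rat_in_itvoo; rewrite ltrDl.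
rewrite in_itv/= => /andP[aq qe].
apply: (@le_trans _ _ (ratr q)%:E); last by rewrite -EFinD lee_fin ltW.
by apply: ereal_inf_lbound; exists q => //; exact/Ca.
Qed.

(** This is where a standard Borel model helps: images of measurable sets under [f] are measurable,
    so the inverse of [f] is measurable on its range. Off the range [h] is constant. *)
Lemma measurable_inverse_selection d' (S : measurableType d')
    (f : G -> R) (r : S -> R) :
  injective f -> (forall A, measurable A -> measurable (f @` A)) ->
  measurable_fun setT r ->
  exists h : S -> G, measurable_fun setT h /\ forall s c, r s = f c -> h s = c.
Proof.
move=> finj mf mr; pose h s : G := get [set c | f c = r s].
have hE s c : r s = f c -> h s = c.
  move=> rs; apply: finj; rewrite -rs.
  by apply: (@getPex _ [set c | f c = r s]); exists c.
exists h; split => // _ B mB; rewrite setTI.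
have mrS (A : set R) : measurable A -> measurable (r @^-1` A).
  by move=> mA; rewrite -[X in measurable X]setTI; exact: mr.
rewrite (_ : _ @^-1` _ = r @^-1` (f @` B) `|`
    (if `[< B point >] then ~` (r @^-1` (f @` setT)) else set0)).
  apply: measurableU; first by apply: mrS; exact: mf.
  by case: ifP => // _; apply: measurableC; apply: mrS; exact: mf.
have hpoint s : ~ (f @` setT) (r s) -> h s = point.
  by move=> ns; apply: xgetPN => c fc; apply: ns; exists c.
apply/seteqP; split => s /=.
  have [[c _ fc]|nf] := pselect ((f @` setT) (r s)).
    by rewrite (hE _ _ (esym fc)) => Bc; left; exists c.
  by rewrite hpoint// => Bp; right; rewrite asboolT.
move=> [[c Bc fc]|]; first by rewrite (hE _ _ (esym fc)).
by case: asboolP => // Bp ns; rewrite hpoint.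
Qed.

End measurable_selections.

(** * From the sigma-algebra to the point isomorphism *)

Section poisson_boundary.
Context {R : realType} {W : pointedCountType}.
Context {d : measure_display} {T : measurableType d} {Q : probability T R}.
Variables (mu m : probability (word W) R) (X : nat -> {RV Q >-> word W}).
Hypothesis m_gt0 : forall g : word W, (0 < m [set g])%E.
Local Open Scope ereal_scope.

Local Notation P := (walk_law X ([::] : word W)).
Local Notation Pm := (walk_law_mix X m).

Lemma walk_law_ge0 g (N : set (path_space W)) : 0 <= walk_law X g N.
Proof. exact: (measure_ge0 Q). Qed.

(** As [m] charges every word, null sets of the mixture are null from every start; this carries
    equalities mod 0 over to the walk started at the empty word. *)
Lemma walk_law_mix0 (N : set (path_space W)) : measurable N ->
  Pm N = 0 <-> forall g, walk_law X g N = 0.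
Proof.
move=> mN; have pos g : 0 <= m [set g] * walk_law X g N.
  by rewrite mule_ge0// ?walk_law_ge0// ltW.
split => [N0 g|N0]; last first.
  by rewrite /walk_law_mix esum1// => g _; rewrite N0 mule0.
have : m [set g] * walk_law X g N <= 0.
  rewrite -N0 -[leLHS](@esum_set1 _ _ g (fun g => m [set g] * walk_law X g N))//.
  by rewrite [leLHS]esum_mkcond; apply: le_esum => h _; case: ifP.
rewrite pmule_rle0// => le0.
by apply/eqP; rewrite eq_le le0 walk_law_ge0.
Qed.

Lemma negligible_walk_law (N : set (path_space W)) :
  Pm.-negligible N -> P.-negligible N.
Proof.
by move=> [A [mA A0 NA]]; exists A; split => //; exact: (walk_law_mix0 mA).1.
Qed.

Lemma probability_null_bigcup (I : countType) (F : I -> set T) :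
  (forall i, measurable (F i)) -> (forall i, Q (F i) = 0) ->
  Q (\bigcup_i F i) = 0.
Proof.
move=> mF F0; pose G n := if choice.unpickle n is Some i then F i else set0.
have mG n : measurable (G n) by rewrite /G; case: choice.unpickle.
have G0 n : Q (G n) = 0 by rewrite /G; case: choice.unpickle => //; rewrite measure0.
have -> : \bigcup_i F i = \bigcup_n G n.
  apply/seteqP; split => t; last first.
    by move=> [n _]; rewrite /G; case: choice.unpickle => // i Fi; exists i.
  by move=> [i _ Fi]; exists (choice.pickle i) => //; rewrite /G choice.pickleK.
apply/eqP; rewrite eq_le measure_ge0 andbT.
apply: (le_trans (measure_sigma_subadditive Q mG (bigcupT_measurable _ mG) (@subset_refl _ _))).
by rewrite eseries0// => n _ _; exact: G0.
Qed.

Lemma walk_law_null_bigcup g (I : countType) (N : I -> set (path_space W)) :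
  (forall i, measurable (N i)) -> (forall i, walk_law X g (N i) = 0) ->
  walk_law X g (\bigcup_i N i) = 0.
Proof.
move=> mN N0; rewrite /walk_law /pushforward preimage_bigcup.
apply: probability_null_bigcup => i; last exact: N0.
exact: measurable_walk_preimage.
Qed.

Lemma path_equiv_limit (x y : path_space W) : path_equiv x y -> limit_map x = limit_map y.
Proof.
move=> [i [j xy]]; rewrite -(limit_map_shift x i) -(limit_map_shift y j).
by congr limit_map; apply/funext => n; rewrite addnC xy addnC.
Qed.

Lemma equal_mod0_refl d' (S : measurableType d') (p : set S -> \bar R) A :
  p set0 = 0 -> equal_mod0 p A A.
Proof. by move=> p0; rewrite /equal_mod0 setYK; exists set0; split. Qed.

Lemma walk_law_mix_set0 : Pm set0 = 0.
Proof.
apply/(walk_law_mix0 measurable0) => g.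
by rewrite /walk_law /pushforward preimage_set0 measure0.
Qed.

Lemma measurable_limit_preimage (C : set (infinite_words W)) :
  measurable C -> measurable (limit_map @^-1` C : set (path_space W)).
Proof.
by move=> mC; rewrite -[X in measurable X]setTI; exact: measurable_limit_map.
Qed.

Lemma limit_preimage_invariant (C : set (infinite_words W)) :
  measurable C -> invariant_algebra Pm (limit_map @^-1` C).
Proof.
move=> mC; have mL := measurable_limit_preimage mC; split => //.
exists (limit_map @^-1` C); split => //.
  by move=> x y /path_equiv_limit xy; rewrite /preimage /= xy.
exact/equal_mod0_refl/walk_law_mix_set0.
Qed.

Hypothesis invariant_limit : forall B : set (path_space W),
  measurable B -> union_of_classes B ->
  exists C : set (infinite_words W),
    measurable C /\ P (B `+` limit_map @^-1` C) = 0.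

Lemma invariant_algebra_limit A : invariant_algebra Pm A ->
  exists C : set (infinite_words W),
    measurable C /\ equal_mod0 P A (limit_map @^-1` C).
Proof.
move=> [mA [B [mB uB /negligible_walk_law[N [mN N0 ABN]]]]].
have [C [mC C0]] := invariant_limit mB uB; exists C; split => //.
have mL := measurable_limit_preimage mC; have mY := measurableY mB mL.
exists (N `|` (B `+` limit_map @^-1` C)); split.
- exact: measurableU.
- apply/eqP; rewrite eq_le walk_law_ge0 andbT /walk_law /pushforward preimage_setU.
  apply: (le_trans (measureU2 _ (measurable_walk_preimage X [::] mN)
    (measurable_walk_preimage X [::] mY))).
  by rewrite [X in X + _]N0 [X in _ + X]C0 adde0.
- move=> x AC; have [xAB|nxAB] := pselect ((A `+` B) x); first by left; exact: ABN.
  right; move: AC nxAB => /=; have [?|?] := pselect (B x);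
    have [?|?] := pselect (A x); tauto.
Qed.

(** Points are determined by the letters on one side and by the level sets of [f] at rational
    heights on the other. Each of these countably many events agrees with an event of the other side
    off a null set, and the union of the null sets is null. *)
Lemma boundary_map_isomorphism d' (G : measurableType d')
    (bnd : path_space W -> G) : standard_borel (R := R) G -> boundary_map Pm bnd ->
  exists Lambda : G -> infinite_words W,
    {ae Pm, forall x, Lambda (bnd x) = limit_map x} /\
    isomorphism_mod0 (pushforward P bnd) (hitting_measure P) Lambda.
Proof.
move=> [f [mf finj fim]] [mbnd bndP].
have mbndS (A : set G) : measurable A -> measurable (bnd @^-1` A).
  by move=> mA; rewrite -[X in measurable X]setTI; exact: mbnd.
have mfS (A : set R) : measurable A -> measurable (f @^-1` A).
  by move=> mA; rewrite -[X in measurable X]setTI; exact: mf.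
(* [L] recovers the limit word letter by letter from the point of [G]. *)
pose letter (p : nat * W) : set (infinite_words W) := [set xi | xi p.1 = p.2].
have mletter p : measurable (letter p).
  exact: (@measurable_coordinate W p.1 [set p.2]).
have letterP p : exists CN : set G * set (path_space W),
    [/\ measurable CN.1, measurable CN.2, Pm CN.2 = 0 &
        (limit_map @^-1` letter p) `+` (bnd @^-1` CN.1) `<=` CN.2].
  have mL := measurable_limit_preimage (mletter p).
  have [C [mC [N [mN N0 sN]]]] := (bndP _ mL).1 (limit_preimage_invariant (mletter p)).
  by exists (C, N).
pose CN p := projT1 (cid (letterP p)).
have mC p : measurable (CN p).1 by have [] := projT2 (cid (letterP p)).
have mN p : measurable (CN p).2 by have [] := projT2 (cid (letterP p)).
have N0 p : Pm (CN p).2 = 0 by have [] := projT2 (cid (letterP p)).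
have sN p : (limit_map @^-1` letter p) `+` (bnd @^-1` (CN p).1) `<=` (CN p).2.
  by have [] := projT2 (cid (letterP p)).
have [L [mL LP]] := measurable_sequence_selection (fun k w => mC (k, w)).
pose N := \bigcup_p (CN p).2.
have measN : measurable N by apply: countable_bigcupT_measurable.
have PmN : Pm N = 0.
  apply/(walk_law_mix0 measN) => g; apply: walk_law_null_bigcup => // p.
  exact: (walk_law_mix0 (mN p)).1.
have LN x : ~ N x -> L (bnd x) = limit_map x.
  move=> nN; apply: LP => k w.
  have {}nN : ~ (CN (k, w)).2 x by move=> ?; apply: nN; exists (k, w).
  have := sN (k, w) x; rewrite /letter /= => h; split => h'.
    by apply: contrapT => ?; apply: nN; apply: h; right.
  by apply: contrapT => ?; apply: nN; apply: h; left.
have PN : P N = 0 by exact: (walk_law_mix0 measN).1.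
exists L; split.
  by exists N; split => // x /=; apply: contra_notP => nN; exact: LN.
(* The inverse [h] recovers the level sets of [f] from the limit word. *)
have levelP (q : rat) : exists CM : set (infinite_words W) * set (path_space W),
    [/\ measurable CM.1, measurable CM.2, P CM.2 = 0 &
        (bnd @^-1` [set c | (f c < ratr q)%R]) `+` (limit_map @^-1` CM.1) `<=` CM.2].
  have mlt : measurable [set c | (f c < ratr q)%R].
    have -> : [set c | (f c < ratr q)%R] = f @^-1` `]-oo, ratr q[%classic.
      by apply/seteqP; split => c /=; rewrite in_itv.
    exact: mfS.
  have mA := mbndS _ mlt.
  have [|C [mC' [M [mM M0 sM]]]] := @invariant_algebra_limit (bnd @^-1` [set c | (f c < ratr q)%R]).
    apply/(bndP _ mA); exists [set c | (f c < ratr q)%R]; split => //.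
    exact/equal_mod0_refl/walk_law_mix_set0.
  by exists (C, M).
pose CM q := projT1 (cid (levelP q)).
have mCM q : measurable (CM q).1 by have [] := projT2 (cid (levelP q)).
have mM q : measurable (CM q).2 by have [] := projT2 (cid (levelP q)).
have M0 q : P (CM q).2 = 0 by have [] := projT2 (cid (levelP q)).
have sM q : (bnd @^-1` [set c | (f c < ratr q)%R]) `+` (limit_map @^-1` (CM q).1)
    `<=` (CM q).2.
  by have [] := projT2 (cid (levelP q)).
have [r [mr rP]] := @measurable_real_selection R _ _ (fun q => (CM q).1) mCM.
have [h [mh hP]] := measurable_inverse_selection finj fim mr.
pose M := N `|` \bigcup_q (CM q).2.
have mMq : measurable (\bigcup_q (CM q).2) by apply: countable_bigcupT_measurable.
have measM : measurable M by exact: measurableU.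
have mMt := measurable_walk_preimage X [::] measM.
have PM : P M = 0.
  apply/eqP; rewrite eq_le walk_law_ge0 andbT /walk_law /pushforward preimage_setU.
  apply: (le_trans (measureU2 _ (measurable_walk_preimage X [::] measN)
    (measurable_walk_preimage X [::] mMq))).
  have -> : 0 = P N + P (\bigcup_q (CM q).2); last by [].
  by rewrite PN walk_law_null_bigcup// adde0.
have LM x : ~ M x -> L (bnd x) = limit_map x.
  by move=> nM; apply: LN => Nx; apply: nM; left.
have hM x : ~ M x -> h (limit_map x) = bnd x.
  move=> nM; apply: hP; apply: rP => q.
  have {}nM : ~ (CM q).2 x by move=> ?; apply: nM; right; exists q.
  have := sM q x => /= s; split => h'.
    by apply: contrapT => ?; apply: nM; apply: s; right.
  by apply: contrapT => ?; apply: nM; apply: s; left.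
have P0 (E : set (path_space W)) : measurable E -> E `<=` M -> P E = 0.
  move=> mE EM; apply/eqP; rewrite eq_le walk_law_ge0 andbT -PM.
  apply: le_probability => //; first exact: measurable_walk_preimage.
  by move=> t; exact: EM.
have mLS (C : set (infinite_words W)) : measurable C -> measurable (L @^-1` C).
  by move=> mC'; rewrite -[X in measurable X]setTI; exact: mL.
split => //.
  move=> C mC'; rewrite /hitting_measure /pushforward /walk_law /pushforward.
  have mE1 := mbndS _ (mLS _ mC'); have mE2 := measurable_limit_preimage mC'.
  have half (E E' : set (path_space W)) : measurable E -> measurable E' ->
      E `<=` E' `|` M -> P E <= P E'.
    move=> mE mE' EE'; rewrite -[leRHS]adde0 -PM.
    apply: le_trans (measureU2 Q (measurable_walk_preimage X [::] mE') mMt).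
    apply: le_probability; [exact: measurable_walk_preimage| |by move=> t /EE'].
    by apply: measurableU => //; exact: measurable_walk_preimage.
  apply/eqP; rewrite eq_le; apply/andP; split; apply: half => //.
    by move=> x /= Lx; have [|nM] := pselect (M x); [right|left; rewrite /= -LM].
  by move=> x /= Lx; have [|nM] := pselect (M x); [right|left; rewrite /= LM].
exists h; split => //.
  (* Equality in [G] is tested through the injective [f], because equality of two measurable real
     functions is a measurable event. *)
  have mneq : measurable [set c | f (h (L c)) != f c].
    have mhL : measurable_fun setT (fun c => f (h (L c))).
      exact: (measurableT_comp mf (measurableT_comp mh mL)).
    have -> : [set c | f (h (L c)) != f c] = (fun c => f (h (L c)) == f c) @^-1` [set false].
      by apply/seteqP; split => c /= => [/negbTE|->].
    by rewrite -[X in measurable X]setTI; exact: (measurable_fun_eqr mhL mf).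
  exists [set c | f (h (L c)) != f c]; split => //.
    apply: P0; first exact: mbndS.
    by move=> x /= neq; apply: contrapT => nM; move: neq; rewrite LM// hM// eqxx.
  by move=> c /= hc; apply/eqP => /finj.
pose bad (p : nat * W) : set (infinite_words W) :=
  [set y | L (h y) p.1 = p.2 /\ y p.1 <> p.2].
have mbad p : measurable (bad p).
  apply: measurableI.
    have mLh : measurable_fun setT (fun y => L (h y)) by exact: (measurableT_comp mL mh).
    rewrite -[X in measurable X]setTI; exact: (mLh measurableT _ (mletter p)).
  exact: measurableC (mletter p).
have mbads : measurable (\bigcup_p bad p) by apply: countable_bigcupT_measurable.
exists (\bigcup_p bad p); split => //.
  apply: P0; first exact: measurable_limit_preimage.
  move=> x /= [p _ [h1 h2]]; apply: contrapT => nM; apply: h2.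
  by rewrite -h1 hM// LM.
move=> y /= hy; apply: contrapT => ny; apply: hy; apply/funext => k.
by apply: contrapT => hk; apply: ny; exists (k, L (h y) k) => //; split => //= /esym.
Qed.

End poisson_boundary.

Theorem theorem1p1 (R : realType) (W : pointedCountType)
    (mu m : probability (word W) R)
    (d : measure_display) (T : measurableType d) (Q : probability T R)
    (X : nat -> {RV Q >-> word W}) :
  generating mu ->
  (forall g : word W, (0 < m [set g])%E) ->
  iid_with_law mu X ->
  finite_entropy mu \/ finite_log_moment mu ->
  is_poisson_boundary (walk_law_mix X m) (walk_law X ([::] : word W)).
Proof.
move=> gen m0 iidX fin.
have invariant_limit := invariant_set_limit iidX (generating_lt1 gen)
  (entropy_size_lty iidX fin).
split; first exact: invariant_algebra_limit.
exact: boundary_map_isomorphism.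
Qed.
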